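(* Let $A$ be an $\mathfrak h$-trivial formal deformation of the $\mathfrak a$-algebra $U(\mathfrak{sl}_2)$. Then there is a unique regular colouring $\psi$ such that $A$ and $U_h(\psi)$ are isomorphic as $U_h(\mathfrak a)$-algebras.
   Context: $\mathbb k$ is a field of characteristic zero, and $\mathbb k[[h]]$ is the ring of formal power series over $\mathbb k$. For a $\mathbb k$-vector space $V_0$, $V_0[[h]]$ denotes the module of formal series $\sum_{m\ge0}v_mh^m$ with $v_m\in V_0$. A $\mathbb k[[h]]$-module is topologically free if it is isomorphic to some $V_0[[h]]$. For a $\mathbb k[[h]]$-linear map $g$, $\bar g$ denotes the induced map modulo $h$. $\mathfrak a$ is the Lie algebra over $\mathbb k$ generated by $H,X^-,X^+$ subject to $[H,X^\pm]=\pm2X^\pm$. An $\mathfrak a$-algebra is an algebra with a structural homomorphism from $U(\mathfrak a)$; homomorphisms of such algebras commute with structural maps. $U(\mathfrak{sl}_2)$ is an $\mathfrak a$-algebra via the canonical projection. We set $U_h(\mathfrak a):=U(\mathfrak a)[[h]]$. For a $U_h(\mathfrak a)$-algebra $A$, the quotient $A/hA$ is an $\mathfrak a$-algebra. A formal deformation of the $\mathfrak a$-algebra $U(\mathfrak{sl}_2)$ is a $U_h(\mathfrak a)$-algebra $A$ that is topologically free as a $\mathbb k[[h]]$-module and satisfies $A/hA\cong U(\mathfrak{sl}_2)$ as $\mathfrak a$-algebras. The images of $H,X^\pm$ in $A$ are again denoted $H,X^\pm$. Such an $A$ is $\mathfrak h$-trivial if there is a $\mathbb k[[h]]$-algebra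 isomorphism $g:U(\mathfrak{sl}_2)[[h]]\to A$ with $g(H)=H$ and $\bar g:U(\mathfrak{sl}_2)\to A/hA$ an isomorphism of $\mathfrak a$-algebras. A colouring is a sequence $\psi=(\psi^k)_{k\ge1}$ of functions $\psi^k:\mathbb Z\to\mathbb k[[h]]$ satisfying: - (C1) $\psi^k(n)\equiv k(n-k+1)\bmod h$; - (C2) $\psi^{n+1}(n)=0$ for all $n\ge0$; - (C3) $\psi^{n+k+1}(n)=\psi^k(-n-2)$ for all $k\ge1$ and all $n\ge0$. Write $\psi^k(n)=\sum_m\psi^k_m(n)h^m$. The colouring $\psi$ is regular if, for each $m$, there is $P_m\in\mathbb k[x,y]$ with $\psi^k_m(n)=P_m(k,n)$ for all $k\ge1$ and $n\in\mathbb Z$. $V_h(n,\psi)$ is the representation of $U_h(\mathfrak a)$ on $(\bigoplus_{k\ge0}\mathbb k b_k)[[h]]$ with the following action: - $H.b_k=(n-2k)b_k$; - $X^-.b_k=b_{k+1}$; - $X^+.b_0=0$, and $X^+.b_k=\psi^k(n)b_{k-1}$ for $k\ge1$. $U_h(\psi)$ is the quotient of $U_h(\mathfrak a)$ by the two-sided ideal of elements that act by zero on all $V_h(n,\psi)$, $n\in\mathbb Z$. It is a $U_h(\mathfrak a)$-algebra via the projection. *)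

(* Defs.v *)
From HB Require Import structures.
From mathcomp Require Import all_boot all_order all_algebra.
Set Implicit Arguments.
Unset Strict Implicit.
Unset Printing Implicit Defensive.
Import Order.TTheory GRing.Theory Num.Theory.
Local Open Scope ring_scope.

Section Defs.
Variable k : fieldType.

Definition ps := nat -> k.
Definition ps0 : ps := fun _ => 0.
Definition ps1 : ps := fun m => if m == 0%N then 1 else 0.
Definition pscst (c : k) : ps := fun m => if m == 0%N then c else 0.
Definition hpow (N : nat) : ps := fun m => if m == N then 1 else 0.
Definition psadd (f g : ps) : ps := fun m => f m + g m.
Definition psmul (f g : ps) : ps :=
  fun m => \sum_(i < m.+1) f i * g (m - i)%N.

Definition psscale (V0 : lmodType k) (f : ps) (v : nat -> V0) : nat -> V0 :=
  fun m => \sum_(i < m.+1) f i *: v (m - i)%N.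

Record kh_algebra (A : nzRingType) (sc : ps -> A -> A) : Prop := {
  sc_addr : forall f a b, sc f (a + b) = sc f a + sc f b;
  sc_addl : forall f g a, sc (psadd f g) a = sc f a + sc g a;
  sc_mulA : forall f g a, sc (psmul f g) a = sc f (sc g a);
  sc_one  : forall a, sc ps1 a = a;
  sc_mull : forall f a b, sc f (a * b) = sc f a * b;
  sc_mulr : forall f a b, sc f (a * b) = a * sc f b
}.

Definition top_free (A : nzRingType) (sc : ps -> A -> A) : Prop :=
  exists (V0 : lmodType k) (phi : (nat -> V0) -> A),
    bijective phi /\
    (forall v w, phi (fun m => v m + w m) = phi v + phi w) /\
    (forall f v, phi (psscale f v) = sc f (phi v)).

Definition in_hNA (A : nzRingType) (sc : ps -> A -> A) (N : nat) (a : A) : Prop :=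
  exists b, a = sc (hpow N) b.

Definition hsums (A : nzRingType) (sc : ps -> A -> A) (s : nat -> A) (a : A) : Prop :=
  forall N, in_hNA sc N (a - \sum_(m < N) s m).

(* ---------- noncommutative polynomial expressions in H, X^-, X^+ ----------
   Elements of U(a) (resp. U(sl2)) are represented by such expressions,
   modulo the defining relations. *)
Inductive term : Type :=
| TC of k | TH | TXm | TXp | TAdd of term & term | TMul of term & term.

Fixpoint teval (R : nzRingType) (emb : k -> R) (gH gXm gXp : R) (t : term) : R :=
  match t with
  | TC c => emb c
  | TH => gH
  | TXm => gXm
  | TXp => gXp
  | TAdd t1 t2 => teval emb gH gXm gXp t1 + teval emb gH gXm gXp t2
  | TMul t1 t2 => teval emb gH gXm gXp t1 * teval emb gH gXm gXp t2
  end.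

Definition a_rel (R : nzRingType) (gH gXm gXp : R) : Prop :=
  gH * gXp - gXp * gH = gXp *+ 2 /\ gH * gXm - gXm * gH = - (gXm *+ 2).

Definition sl2_rel (R : nzRingType) (gH gXm gXp : R) : Prop :=
  a_rel gH gXm gXp /\ gXp * gXm - gXm * gXp = gH.

(* equality in U(sl2) of the classes of two expressions (universal property) *)
Definition sl2_eq (t t' : term) : Prop :=
  forall (C : algType k) (gH gXm gXp : C), sl2_rel gH gXm gXp ->
    teval (fun c => c%:A) gH gXm gXp t = teval (fun c => c%:A) gH gXm gXp t'.

(* ---------- U_h(a)-algebras ----------
   For a topologically free k[[h]]-algebra A, a U_h(a)-algebra structure
   U(a)[[h]] -> A is given by the images HA, XmA, XpA of H, X^-, X^+
   (satisfying a_rel); it sends sum_m h^m u_m to sum_m h^m u_m(HA,XmA,XpA). *)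
Definition embA (A : nzRingType) (sc : ps -> A -> A) (c : k) : A := sc (pscst c) 1.

Definition evA (A : nzRingType) (sc : ps -> A -> A) (gH gXm gXp : A) (t : term) : A :=
  teval (embA sc) gH gXm gXp t.

Definition ser (A : nzRingType) (sc : ps -> A -> A) (gH gXm gXp : A)
  (u : nat -> term) : nat -> A :=
  fun m => sc (hpow m) (evA sc gH gXm gXp (u m)).

(* formal deformation of the a-algebra U(sl2) : topologically free, and
   A/hA ~= U(sl2) as a-algebras, i.e. the canonical a-algebra map
   U(sl2) -> A/hA (t |-> t(H,X^-,X^+) mod h) is well defined and bijective. *)
Definition formal_deformation (A : nzRingType) (sc : ps -> A -> A) (HA XmA XpA : A) :=
  top_free sc /\
  (forall a, exists t, in_hNA sc 1 (a - evA sc HA XmA XpA t)) /\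
  (forall t t', in_hNA sc 1 (evA sc HA XmA XpA t - evA sc HA XmA XpA t')
                <-> sl2_eq t t').

(* h-trivial: there is a k[[h]]-algebra isomorphism g : U(sl2)[[h]] -> A with
   g(H) = H and gbar : U(sl2) -> A/hA an a-algebra isomorphism.  Such g is
   determined by Fp = g(X^-), Ep = g(X^+), and g(sum h^m u_m) = sum h^m g(u_m). *)
Definition h_trivial (A : nzRingType) (sc : ps -> A -> A) (HA XmA XpA : A) :=
  exists Fp Ep : A,
    sl2_rel HA Fp Ep /\
    (* g surjective *)
    (forall a, exists u, hsums sc (ser sc HA Fp Ep u) a) /\
    (* g well defined and injective on U(sl2)[[h]] *)
    (forall u u', (exists a, hsums sc (ser sc HA Fp Ep u) a /\
                             hsums sc (ser sc HA Fp Ep u') a)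
                  <-> (forall m, sl2_eq (u m) (u' m))) /\
    (* gbar commutes with the a-algebra structure maps ... *)
    in_hNA sc 1 (Fp - XmA) /\ in_hNA sc 1 (Ep - XpA) /\
    (* ... and gbar is bijective *)
    (forall a, exists t, in_hNA sc 1 (a - evA sc HA Fp Ep t)) /\
    (forall t t', in_hNA sc 1 (evA sc HA Fp Ep t - evA sc HA Fp Ep t')
                  <-> sl2_eq t t').

(* ---------- colourings ----------
   psi k n = psi^k(n) in k[[h]] (the value at k = 0 is irrelevant/unused). *)
Definition colouring (psi : nat -> int -> ps) : Prop :=
  (forall (kk : nat) (n : int), (0 < kk)%N ->
     psi kk n 0%N = ((kk%:Z * (n - kk%:Z + 1))%:~R)) /\
  (forall n : nat, psi n.+1 n%:Z =1 ps0) /\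
  (forall kk n : nat, (0 < kk)%N -> psi (n + kk).+1 n%:Z =1 psi kk (- n%:Z - 2)).

Definition regular (psi : nat -> int -> ps) : Prop :=
  forall m : nat, exists P : {poly {poly k}},
    forall (kk : nat) (n : int), (0 < kk)%N ->
      psi kk n m = (P.[(kk%:R)%:P]).[n%:~R].

Definition regular_colouring psi := colouring psi /\ regular psi.

(* ---------- the representations V_h(n, psi) ----------
   a vector is given by its coordinates (in k[[h]]) on the b_i *)
Definition vec := nat -> ps.
Definition bvec (j : nat) : vec := fun i => if i == j then ps1 else ps0.

Fixpoint tact (psi : nat -> int -> ps) (n : int) (t : term) (v : vec) : vec :=
  match t with
  | TC c => fun i m => c * v i m
  | TH => fun i m => (n - (2 * i)%N%:Z)%:~R * v i m
  | TXm => fun i => if i is i'.+1 then v i' else ps0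
  | TXp => fun i => psmul (psi i.+1 n) (v i.+1)
  | TAdd t1 t2 => fun i m => tact psi n t1 v i m + tact psi n t2 v i m
  | TMul t1 t2 => tact psi n t1 (tact psi n t2 v)
  end.

(* coefficient of h^M in the b_i-coordinate of (sum_m h^m u_m) . b_j in V_h(n,psi) *)
Definition actUh (psi : nat -> int -> ps) (n : int) (u : nat -> term)
  (j i M : nat) : k :=
  \sum_(m < M.+1) tact psi n (u m) (bvec j) i (M - m)%N.

(* u and u' have the same image in U_h(psi), i.e. u - u' acts by zero on
   every V_h(n, psi), n in Z *)
Definition Uh_equiv (psi : nat -> int -> ps) (u u' : nat -> term) : Prop :=
  forall (n : int) (j i M : nat), actUh psi n u j i M = actUh psi n u' j i M.

(* A ~= U_h(psi) as U_h(a)-algebras: the structure map U_h(a) -> A factors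
   through a bijection U_h(psi) -> A. *)
Definition Uh_iso (A : nzRingType) (sc : ps -> A -> A) (HA XmA XpA : A)
  (psi : nat -> int -> ps) : Prop :=
  (forall a, exists u, hsums sc (ser sc HA XmA XpA u) a) /\
  (forall u u', (exists a, hsums sc (ser sc HA XmA XpA u) a /\
                           hsums sc (ser sc HA XmA XpA u') a)
                <-> Uh_equiv psi u u').

End Defs.

(* Main.v *)
Require Import Defs.
From HB Require Import structures.
From mathcomp Require Import all_boot all_order all_algebra.
From mathcomp Require Import boolp ring zify.
Set Implicit Arguments.
Unset Strict Implicit.
Unset Printing Implicit Defensive.
Import GRing.Theory.
Local Open Scope ring_scope.

(** Through g, A acts on every Verma module V(n)[[h]] of sl2.  Since X^- and X^+
    have weights -2 and 2, they act by X^- b_i = p_i b_(i+1) and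
    X^+ b_(i+1) = q_i b_i with p_i = 1 mod h, and rescaling b_i by
    p_0 ... p_(i-1) identifies V(n)[[h]] with V_h(n, psi), where
    psi^(i+1)(n) = q_i p_i.  Condition (C1) holds because g is the identity mod h;
    (C2) and (C3) come from the embedding of V(-n-2) in V(n); regularity and the
    faithfulness of the action on all V(n) together, hence A = U_h(psi), come
    from the PBW normal form F^a p(H) E^b.  Conversely, if A = U_h(psi'), then
    g turns V_h(n, psi') into an sl2-module with the weights of V(n) on which
    g(X^-) acts by units b_i -> b_(i+1), so it is V(n)[[h]] up to rescaling, and
    the entry of X^+ X^- at b_i, which rescaling does not change, gives
    psi' = psi. *)

(** * Formal power series and operators on k[[h]]^N *)

Section PowerSeries.
Variable k : fieldType.
Implicit Types f g r : ps k.

Definition psopp f : ps k := fun m => - f m.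
(** Below degree [N], series multiply like their truncations, so commutativity and associativity are
    inherited from [{poly k}]. *)
Definition pstrunc N f : {poly k} := \poly_(i < N) f i.

Lemma coef_pstruncM N f g m : (m < N)%N ->
  (pstrunc N f * pstrunc N g)`_m = psmul f g m.
Proof.
move=> lt_mN; rewrite coefM; apply: eq_bigr => i _.
by rewrite !coef_poly !ifT //; have := ltn_ord i; lia.
Qed.

Lemma psmul_eqr f g g' m : (forall i, (i <= m)%N -> g i = g' i) ->
  psmul f g m = psmul f g' m.
Proof. by move=> eq_g; apply: eq_bigr => i _; rewrite eq_g // leq_subr. Qed.

Lemma psmulC : commutative (@psmul k).
Proof.
by move=> f g; apply: funext => m; rewrite -!(@coef_pstruncM m.+1) // mulrC.
Qed.

Lemma psmulA : associative (@psmul k).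
Proof.
move=> f g r; apply: funext => m.
have E f1 g1 i : (i <= m)%N ->
    psmul f1 g1 i = (pstrunc m.+1 f1 * pstrunc m.+1 g1)`_i.
  by move=> le_im; rewrite coef_pstruncM.
transitivity ((pstrunc m.+1 f * (pstrunc m.+1 g * pstrunc m.+1 r))`_m).
  rewrite coefM; apply: eq_bigr => i _; rewrite E ?leq_subr //.
  by rewrite coef_poly ltn_ord.
rewrite mulrA coefM; apply: eq_bigr => i _; rewrite E; last by rewrite -ltnS.
by rewrite coef_poly ltnS leq_subr.
Qed.

Lemma psmul1 : left_id (@ps1 k) (@psmul k).
Proof.
move=> f; apply: funext => m; rewrite /psmul big_ord_recl /= mul1r subn0.
by rewrite big1 ?addr0 // => i _; rewrite /ps1 /= mul0r.
Qed.

Lemma psaddA : associative (@psadd k).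
Proof. by move=> f g r; apply: funext => m; rewrite /psadd addrA. Qed.
Lemma psaddC : commutative (@psadd k).
Proof. by move=> f g; apply: funext => m; rewrite /psadd addrC. Qed.
Lemma psadd0 : left_id (@ps0 k) (@psadd k).
Proof. by move=> f; apply: funext => m; rewrite /psadd add0r. Qed.
Lemma psaddN : left_inverse (@ps0 k) psopp (@psadd k).
Proof. by move=> f; apply: funext => m; rewrite /psadd addNr. Qed.
Lemma psmulDl : left_distributive (@psmul k) (@psadd k).
Proof.
move=> f g r; apply: funext => m; rewrite /psmul /psadd -big_split /=.
by apply: eq_bigr => i _; rewrite mulrDl.
Qed.
Lemma ps1_neq0 : @ps1 k <> @ps0 k.
Proof. by move/(congr1 (@^~ 0%N)) => /eqP; rewrite oner_eq0. Qed.

HB.instance Definition _ := gen_eqMixin (ps k).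
HB.instance Definition _ := gen_choiceMixin (ps k).
HB.instance Definition _ :=
  GRing.isZmodule.Build (ps k) psaddA psaddC psadd0 psaddN.
HB.instance Definition _ := GRing.Zmodule_isComNzRing.Build (ps k)
  psmulA psmulC psmul1 psmulDl (introN eqP ps1_neq0).

Lemma psE0 m : (0 : ps k) m = 0. Proof. by []. Qed.
Lemma psED f g m : (f + g) m = f m + g m. Proof. by []. Qed.
Lemma psEN f m : (- f) m = - f m. Proof. by []. Qed.
Lemma psEB f g m : (f - g) m = f m - g m. Proof. by []. Qed.
Lemma psEM f g m : (f * g) m = psmul f g m. Proof. by []. Qed.
Lemma psEsum I (r : seq I) (P : pred I) (F : I -> ps k) m :
  (\sum_(i <- r | P i) F i) m = \sum_(i <- r | P i) F i m.
Proof. by elim/big_rec2: _ => // i x y _ <-. Qed.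

Lemma psM0E f g : (f * g) 0%N = f 0%N * g 0%N.
Proof. by rewrite psEM /psmul big_ord1. Qed.

Lemma hpowME N f m : (hpow k N * f) m = if (m < N)%N then 0 else f (m - N)%N.
Proof.
rewrite psEM /psmul; case: ltnP => le_Nm.
  rewrite big1 // => i _; rewrite /hpow ifN ?mul0r //.
  by have := ltn_ord i; lia.
rewrite (bigD1 (Ordinal (n := m.+1) (m := N) le_Nm)) //=.
rewrite /hpow eqxx mul1r big1 ?addr0 // => i ne_i.
by rewrite ifN ?mul0r //; apply: contraNneq ne_i => e; apply/eqP/val_inj.
Qed.


Lemma hpowD M N : hpow k (M + N) = hpow k M * hpow k N.
Proof.
apply: funext => m; rewrite hpowME /hpow.
case: ltnP => [lt_mM|le_Mm]; last by rewrite -{1}(subnKC le_Mm) eqn_add2l.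
by rewrite ifN //; lia.
Qed.

Lemma pscstME c f m : (pscst c * f) m = c * f m.
Proof.
rewrite psEM /psmul big_ord_recl /= subn0 big1 ?addr0 // => i _.
by rewrite /pscst /= mul0r.
Qed.

Lemma pscst1 : pscst 1 = 1 :> ps k. Proof. by []. Qed.
Lemma pscst0 : pscst 0 = 0 :> ps k.
Proof. by apply: funext => m; rewrite /pscst; case: ifP. Qed.
Lemma pscstD a b : pscst (a + b) = pscst a + pscst b :> ps k.
Proof.
by apply: funext => m; rewrite psED /pscst; case: ifP => // _; rewrite addr0.
Qed.
Lemma pscstM a b : pscst (a * b) = pscst a * pscst b :> ps k.
Proof.
by apply: funext => m; rewrite pscstME /pscst; case: ifP => // _; rewrite mulr0.
Qed.
Lemma pscstN a : pscst (- a) = - pscst a :> ps k.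
Proof.
by apply: funext => m; rewrite psEN /pscst; case: ifP => // _; rewrite oppr0.
Qed.

(** Once the coefficients of [g] below [m] vanish, the coefficient of [f * g] at [m] is [f 0 * g m].
    This cancels the rescaling factors later on. *)
Lemma psmul_eq0 f g : f 0%N != 0 -> f * g = 0 -> g = 0.
Proof.
move=> f0 fg0; apply: funext => m; rewrite psE0.
elim/ltn_ind: m => m IH; move/(congr1 (@^~ m)): fg0.
rewrite psE0 psEM /psmul big_ord_recl /= subn0 big1 => [|i _].
  by rewrite addr0 => /eqP; rewrite mulf_eq0 (negbTE f0) => /eqP.
by rewrite IH ?mulr0 // /bump /=; have := ltn_ord i; lia.
Qed.

End PowerSeries.

Section Operators.
Variable k : fieldType.
Implicit Types u v w : vec k.

Definition vec0 : vec k := fun _ => 0.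
Definition vecadd u v : vec k := fun i => u i + v i.
Definition vecopp u : vec k := fun i => - u i.
Definition vecscale (f : ps k) u : vec k := fun i => f * u i.

Lemma vecaddA : associative vecadd.
Proof. by move=> u v w; apply: funext => i; apply: addrA. Qed.
Lemma vecaddC : commutative vecadd.
Proof. by move=> u v; apply: funext => i; apply: addrC. Qed.
Lemma vecadd0 : left_id vec0 vecadd.
Proof. by move=> u; apply: funext => i; apply: add0r. Qed.
Lemma vecaddN : left_inverse vec0 vecopp vecadd.
Proof. by move=> u; apply: funext => i; apply: addNr. Qed.

HB.instance Definition _ := gen_eqMixin (vec k).
HB.instance Definition _ := gen_choiceMixin (vec k).
HB.instance Definition _ :=
  GRing.isZmodule.Build (vec k) vecaddA vecaddC vecadd0 vecaddN.

Lemma vecscaleA f g v : vecscale f (vecscale g v) = vecscale (f * g) v.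
Proof. by apply: funext => i; apply: mulrA. Qed.
Lemma vecscale1 : left_id 1 vecscale.
Proof. by move=> v; apply: funext => i; apply: mul1r. Qed.
Lemma vecscaleDr : right_distributive vecscale +%R.
Proof. by move=> f u v; apply: funext => i; apply: mulrDr. Qed.
Lemma vecscaleDl v : {morph vecscale^~ v : f g / f + g}.
Proof. by move=> f g; apply: funext => i; apply: mulrDl. Qed.

HB.instance Definition _ := GRing.Zmodule_isLmodule.Build (ps k) (vec k)
  vecscaleA vecscale1 vecscaleDr vecscaleDl.

Lemma vecED u v i : (u + v) i = u i + v i. Proof. by []. Qed.
Lemma vecEN u i : (- u) i = - u i. Proof. by []. Qed.
Lemma vecEB u v i : (u - v) i = u i - v i. Proof. by []. Qed.
Lemma vecEZ f u i : (f *: u) i = f * u i. Proof. by []. Qed.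
Lemma vecEsum I (r : seq I) (P : pred I) (F : I -> vec k) j :
  (\sum_(i <- r | P i) F i) j = \sum_(i <- r | P i) F i j.
Proof. by elim/big_rec2: _ => // i x y _ <-. Qed.

(** These operators act on all sequences, a larger module than the series with coefficients in the
    span of the [b_i]. Linearity gives no continuity, so values on the [bvec k j] determine an
    operator only under a finiteness condition such as [ser_band]. *)
Record endv := Endv {
  efun :> vec k -> vec k;
  elin : forall f u v, efun (f *: u + v) = f *: efun u + efun v }.

Lemma endvP (S T : endv) : (forall v, S v = T v) -> S = T.
Proof.
case: S T => [S lS] [T lT] /= /funext eST; case: T / eST lT => lT.
by congr Endv; apply: Prop_irrelevance.
Qed.

Lemma ev0 (T : endv) : T 0 = 0.
Proof.
have := elin T 1 0 0; rewrite !scale1r addr0 => /(congr1 (+%R^~ (- T 0))).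
by rewrite addrK subrr.
Qed.
Lemma evD (T : endv) u v : T (u + v) = T u + T v.
Proof. by have := elin T 1 u v; rewrite !scale1r. Qed.
Lemma evZ (T : endv) f v : T (f *: v) = f *: T v.
Proof. by have := elin T f v 0; rewrite ev0 !addr0. Qed.
Lemma evN (T : endv) v : T (- v) = - T v.
Proof. by rewrite -scaleN1r evZ scaleN1r. Qed.
Lemma evB (T : endv) u v : T (u - v) = T u - T v.
Proof. by rewrite evD evN. Qed.
Lemma ev_sum (T : endv) I (r : seq I) (P : pred I) (F : I -> vec k) :
  T (\sum_(i <- r | P i) F i) = \sum_(i <- r | P i) T (F i).
Proof.
by elim/big_rec2: _ => [|i x y _ <-]; rewrite ?ev0 ?evD.
Qed.

Program Definition endv0 := @Endv (fun _ => 0) _.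
Next Obligation. by rewrite scaler0 addr0. Qed.
Program Definition endvadd (S T : endv) := @Endv (fun v => S v + T v) _.
Next Obligation. by rewrite !elin scalerDr addrACA. Qed.
Program Definition endvopp (S : endv) := @Endv (fun v => - S v) _.
Next Obligation. by rewrite elin opprD scalerN. Qed.
Program Definition endv1 := @Endv (fun v => v) _.
Program Definition endvmul (S T : endv) := @Endv (fun v => S (T v)) _.
Next Obligation. by rewrite !elin. Qed.
Program Definition endvscale f (S : endv) := @Endv (fun v => f *: S v) _.
Next Obligation. by rewrite elin scalerDr !scalerA mulrC. Qed.

HB.instance Definition _ := gen_eqMixin endv.
HB.instance Definition _ := gen_choiceMixin endv.

Lemma endvaddA : associative endvadd.
Proof. by move=> S T U; apply: endvP => v; apply: addrA. Qed.
Lemma endvaddC : commutative endvadd.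
Proof. by move=> S T; apply: endvP => v; apply: addrC. Qed.
Lemma endvadd0 : left_id endv0 endvadd.
Proof. by move=> S; apply: endvP => v; apply: add0r. Qed.
Lemma endvaddN : left_inverse endv0 endvopp endvadd.
Proof. by move=> S; apply: endvP => v; apply: addNr. Qed.
HB.instance Definition _ :=
  GRing.isZmodule.Build endv endvaddA endvaddC endvadd0 endvaddN.

Lemma endvmulA : associative endvmul.
Proof. by move=> S T U; apply: endvP. Qed.
Lemma endvmul1 : left_id endv1 endvmul.
Proof. by move=> S; apply: endvP. Qed.
Lemma endv1mul : right_id endv1 endvmul.
Proof. by move=> S; apply: endvP. Qed.
Lemma endvmulDl : left_distributive endvmul +%R.
Proof. by move=> S T U; apply: endvP. Qed.
Lemma endvmulDr : right_distributive endvmul +%R.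
Proof. by move=> S T U; apply: endvP => v; apply: evD. Qed.
Lemma endv1_neq0 : endv1 != 0.
Proof.
apply/eqP => /(congr1 (fun T : endv => T (bvec k 0) 0%N)).
exact: ps1_neq0.
Qed.
HB.instance Definition _ := GRing.Zmodule_isNzRing.Build endv
  endvmulA endvmul1 endv1mul endvmulDl endvmulDr endv1_neq0.

Lemma endvED (S T : endv) v : (S + T) v = S v + T v. Proof. by []. Qed.
Lemma endvEN (S : endv) v : (- S) v = - S v. Proof. by []. Qed.
Lemma endvEB (S T : endv) v : (S - T) v = S v - T v. Proof. by []. Qed.
Lemma endvEM (S T : endv) v : (S * T) v = S (T v). Proof. by []. Qed.
Lemma endvEsum I (r : seq I) (P : pred I) (F : I -> endv) v :
  (\sum_(i <- r | P i) F i) v = \sum_(i <- r | P i) F i v.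
Proof. by elim/big_rec2: _ => // i x y _ <-. Qed.

Lemma endv_kh_algebra : kh_algebra endvscale.
Proof.
split=> *; apply: endvP => v //=.
- exact: scalerDr.
- exact: scalerDl.
- exact/esym/scalerA.
- exact: scale1r.
- exact/esym/evZ.
Qed.

End Operators.

(** * h-adic sums and morphisms of k[[h]]-algebras *)

Section KhAlgebra.
Variables (k : fieldType) (A : nzRingType) (sc : ps k -> A -> A).
Hypothesis Halg : kh_algebra sc.
Implicit Types (f g : ps k) (a b x y z : A).

Lemma scD f a b : sc f (a + b) = sc f a + sc f b.
Proof. exact: sc_addr. Qed.
Lemma scDl f g a : sc (f + g) a = sc f a + sc g a.
Proof. exact: (sc_addl Halg f g a). Qed.
Lemma scA f g a : sc f (sc g a) = sc (f * g) a.
Proof. exact/esym/(sc_mulA Halg f g a). Qed.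
Lemma sc1 a : sc 1 a = a.
Proof. exact: (sc_one Halg). Qed.
Lemma sc0 f : sc f 0 = 0.
Proof. by apply: (addrI (sc f 0)); rewrite -scD !addr0. Qed.
Lemma sc0l a : sc 0 a = 0.
Proof. by apply: (addrI (sc 0 a)); rewrite -scDl !addr0. Qed.
Lemma scN f a : sc f (- a) = - sc f a.
Proof. by apply: (addrI (sc f a)); rewrite -scD !subrr sc0. Qed.
Lemma scB f a b : sc f (a - b) = sc f a - sc f b.
Proof. by rewrite scD scN. Qed.
Lemma sc_sum f I (r : seq I) (P : pred I) (F : I -> A) :
  sc f (\sum_(i <- r | P i) F i) = \sum_(i <- r | P i) sc f (F i).
Proof. by elim/big_rec2: _ => [|i y1 y2 _ <-]; rewrite ?sc0 ?scD. Qed.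
Lemma scMl f a b : sc f a * b = sc f (a * b).
Proof. exact/esym/(sc_mull Halg). Qed.
Lemma scMr f a b : a * sc f b = sc f (a * b).
Proof. exact/esym/(sc_mulr Halg). Qed.

Lemma embA0 : embA sc 0 = 0.
Proof. by rewrite /embA pscst0 sc0l. Qed.
Lemma embAE c a : embA sc c * a = sc (pscst c) a.
Proof. by rewrite scMl mul1r. Qed.

Lemma in_hNA0 a : in_hNA sc 0 a.
Proof. by exists a; rewrite sc1. Qed.
Lemma in_hNAD N a b : in_hNA sc N a -> in_hNA sc N b -> in_hNA sc N (a + b).
Proof. by move=> [c ->] [d ->]; exists (c + d); rewrite scD. Qed.
Lemma in_hNAN N a : in_hNA sc N a -> in_hNA sc N (- a).
Proof. by move=> [c ->]; exists (- c); rewrite scN. Qed.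
Lemma in_hNAB N a b : in_hNA sc N a -> in_hNA sc N b -> in_hNA sc N (a - b).
Proof. by move=> ha hb; apply: in_hNAD ha _; apply: in_hNAN. Qed.
Lemma in_hNAMl N a b : in_hNA sc N b -> in_hNA sc N (a * b).
Proof. by move=> [c ->]; exists (a * c); rewrite scMr. Qed.
Lemma in_hNAMr N a b : in_hNA sc N a -> in_hNA sc N (a * b).
Proof. by move=> [c ->]; exists (c * b); rewrite scMl. Qed.

Lemma hsums_ext (s s' : nat -> A) a : s =1 s' -> hsums sc s a -> hsums sc s' a.
Proof.
move=> ss' h N; have := h N; congr (in_hNA _ _ (_ - _)).
by apply: eq_bigr => i _.
Qed.

Lemma hsumsD (s t : nat -> A) a b : hsums sc s a -> hsums sc t b ->
  hsums sc (fun m => s m + t m) (a + b).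
Proof.
move=> hs ht N; rewrite big_split /= opprD addrACA.
exact: in_hNAD (hs N) (ht N).
Qed.

Lemma hsumsMl (s : nat -> A) a b : hsums sc s a ->
  hsums sc (fun m => b * s m) (b * a).
Proof.
by move=> hs N; rewrite -mulr_sumr -mulrBr; apply/in_hNAMl/hs.
Qed.

Lemma hsumsMr (s : nat -> A) a b : hsums sc s a ->
  hsums sc (fun m => s m * b) (a * b).
Proof.
by move=> hs N; rewrite -mulr_suml -mulrBl; apply/in_hNAMr/hs.
Qed.

Definition hadic_separated := forall a, (forall N, in_hNA sc N a) -> a = 0.
Definition hadic_complete := forall c : nat -> A,
  exists a, hsums sc (fun m => sc (hpow k m) (c m)) a.

Lemma hsums_inj (s : nat -> A) a b : hadic_separated ->
  hsums sc s a -> hsums sc s b -> a = b.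
Proof.
move=> sep ha hb; apply/eqP; rewrite -subr_eq0; apply/eqP/sep => N.
have := in_hNAB (ha N) (hb N); congr in_hNA.
by rewrite opprB addrA subrK.
Qed.

Lemma hsums_const a :
  hsums sc (fun m => if m is m'.+1 then 0 else a) a.
Proof.
case=> [|N]; first exact: in_hNA0.
rewrite big_ord_recl /= big1 // addr0 subrr.
by exists 0; rewrite sc0.
Qed.

Lemma triangle_sum (F : nat -> nat -> A) N :
  \sum_(i < N) \sum_(j < N - i) F i j =
  \sum_(m < N) \sum_(i < m.+1) F i (m - i)%N.
Proof.
elim: N => [|N IH]; first by rewrite !big_ord0.
rewrite [RHS]big_ord_recr /= -IH big_ord_recr /= subSnn big_ord1.
rewrite [X in _ = _ + X]big_ord_recr /= subnn addrA; congr (_ + _).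
rewrite -big_split /=; apply: eq_bigr => i _.
by rewrite subSn 1?ltnW // big_ord_recr.
Qed.

(** With [C_N], [D_N] the partial sums, the error is [(a - C_N) b + sum_(i < N) h^i c_i (b -
    D_(N-i))], and each summand is divisible by [h^N]. *)
Lemma hsums_cauchy (c d : nat -> A) a b :
  hsums sc (fun m => sc (hpow k m) (c m)) a ->
  hsums sc (fun m => sc (hpow k m) (d m)) b ->
  hsums sc (fun m => sc (hpow k m) (\sum_(i < m.+1) c i * d (m - i)%N)) (a * b).
Proof.
move=> ha hb N; have /choice[r rP] := hb; have [q qP] := ha N.
pose F i j := sc (hpow k (i + j)) (c i * d j).
have -> : \sum_(m < N) sc (hpow k m) (\sum_(i < m.+1) c i * d (m - i)%N) =
          \sum_(i < N) \sum_(j < N - i) F i j.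
  rewrite triangle_sum; apply: eq_bigr => m _; rewrite sc_sum.
  by apply: eq_bigr => i _; rewrite /F subnKC // -ltnS.
exists (q * b + \sum_(i < N) c i * r (N - i)%N).
move/eqP: qP; rewrite subr_eq => /eqP ->.
rewrite mulrDl scD scMl -addrA; congr (_ + _).
rewrite mulr_suml sc_sum -sumrB; apply: eq_bigr => i _.
move: (rP (N - i)%N) => /eqP; rewrite subr_eq => /eqP {1}->.
rewrite scMl mulrDr scD scMr scA -hpowD subnKC 1?ltnW //.
rewrite -addrA mulr_sumr sc_sum -sumrB big1 ?addr0 // => j _.
by rewrite /F scMr scA -hpowD subrr.
Qed.

Lemma hsums_shift (c : nat -> A) a :
  hsums sc (fun m => sc (hpow k m) (c m)) a ->
  hsums sc (fun m => sc (hpow k m) (if m is m'.+1 then c m' else 0))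
    (sc (hpow k 1) a).
Proof.
move=> ha [|N]; first exact: in_hNA0.
have [r rP] := ha N; exists r.
rewrite big_ord_recl /= sc0 add0r (hpowD k 1 N) -scA -rP scB sc_sum.
by congr (_ - _); apply: eq_bigr => i _; rewrite scA -hpowD.
Qed.

Definition tsum (s : seq (term k)) : term k := foldr (@TAdd k) (TC 0) s.

Lemma evA_tsum x y z s :
  evA sc x y z (tsum s) = \sum_(t <- s) evA sc x y z t.
Proof.
elim: s => [|t s IH] /=; first by rewrite big_nil; exact: embA0.
by rewrite big_cons -IH.
Qed.

Definition tcauchy (u v : nat -> term k) m : term k :=
  tsum [seq TMul (u i) (v (m - i)%N) | i <- index_iota 0 m.+1].

Lemma ser_cauchy x y z u v a b :
  hsums sc (ser sc x y z u) a -> hsums sc (ser sc x y z v) b ->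
  hsums sc (ser sc x y z (tcauchy u v)) (a * b).
Proof.
move=> ha hb; apply: hsums_ext (hsums_cauchy ha hb) => m.
rewrite /ser /tcauchy evA_tsum big_map big_mkord.
by congr sc; apply: eq_bigr.
Qed.

Lemma ser_add x y z u v a b :
  hsums sc (ser sc x y z u) a -> hsums sc (ser sc x y z v) b ->
  hsums sc (ser sc x y z (fun m => TAdd (u m) (v m))) (a + b).
Proof.
move=> ha hb; apply: hsums_ext (hsumsD ha hb) => m.
by rewrite /ser -scD.
Qed.

Lemma ser_const x y z t :
  hsums sc (ser sc x y z (fun m => if m is m'.+1 then TC 0 else t))
    (evA sc x y z t).
Proof.
apply: hsums_ext (hsums_const _) => -[|m]; rewrite /ser ?sc1 //.
by rewrite /evA /= embA0 sc0.
Qed.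

Lemma ser_shift x y z u a : hsums sc (ser sc x y z u) a ->
  hsums sc (ser sc x y z (fun m => if m is m'.+1 then u m' else TC 0))
    (sc (hpow k 1) a).
Proof.
move=> ha; apply: hsums_ext (hsums_shift ha) => -[|m] //.
by rewrite /ser /evA /= embA0.
Qed.

(** Successive approximation: subtract a term that agrees modulo [h], divide by [h], and repeat;
    [b m] is the remainder after [m] rounds. *)
Lemma hsums_approx x y z :
  (forall a, exists t, in_hNA sc 1 (a - evA sc x y z t)) ->
  forall a, exists u, hsums sc (ser sc x y z u) a.
Proof.
move=> approx a.
have /choice[T TP] : forall b, exists tb : term k * A,
    b - evA sc x y z tb.1 = sc (hpow k 1) tb.2.
  by move=> b; have [t [c tc]] := approx b; exists (t, c).
pose b m := iter m (fun b => (T b).2) a.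
exists (fun m => (T (b m)).1) => N; exists (b N).
elim: N => [|N IH]; first by rewrite big_ord0 subr0 sc1.
rewrite big_ord_recr /= opprD addrA IH /ser -scB TP -/(b N) scA -hpowD.
by rewrite addn1.
Qed.

(** [sl2_eq] quantifies over [algType k]. This alias of [A] carries the [k]-algebra structure given
    by constant series, with the axioms kept in its type. *)
Definition kalg (_ : kh_algebra sc) : Type := A.
HB.instance Definition _ := GRing.NzRing.on (kalg Halg).
Definition kscale (c : k) (a : kalg Halg) : kalg Halg := sc (pscst c) a.
Lemma kscaleA c d a : kscale c (kscale d a) = kscale (c * d) a.
Proof. by rewrite /kscale scA pscstM. Qed.
Lemma kscale1 : left_id 1 kscale.
Proof. exact: sc1. Qed.
Lemma kscaleDr : right_distributive kscale +%R.
Proof. by move=> c; apply: scD. Qed.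
Lemma kscaleDl a : {morph kscale^~ a : c d / c + d}.
Proof. by move=> c d; rewrite /kscale pscstD scDl. Qed.
HB.instance Definition _ := GRing.Zmodule_isLmodule.Build k (kalg Halg)
  kscaleA kscale1 kscaleDr kscaleDl.
Lemma kscaleAl c (a b : kalg Halg) : c *: (a * b) = (c *: a) * b.
Proof. exact/esym/scMl. Qed.
HB.instance Definition _ := GRing.Lmodule_isLalgebra.Build k (kalg Halg)
  kscaleAl.
Lemma kscaleAr c (a b : kalg Halg) : c *: (a * b) = a * (c *: b).
Proof. exact/esym/scMr. Qed.
HB.instance Definition _ := GRing.Lalgebra_isAlgebra.Build k (kalg Halg)
  kscaleAr.

Lemma teval_kalg (x y z : kalg Halg) t :
  teval (fun c => c%:A) x y z t = evA sc x y z t.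
Proof.
by elim: t => //= t1 IH1 t2 IH2; rewrite /evA /= -!/(evA _ _ _ _ _) -IH1 -IH2.
Qed.

Lemma sl2_eq_evA x y z t t' : sl2_rel x y z -> sl2_eq t t' ->
  evA sc x y z t = evA sc x y z t'.
Proof. by move=> rel h; rewrite -!teval_kalg; apply: (h (kalg Halg)). Qed.

End KhAlgebra.

(** * Morphisms and intertwiners *)

Section Morphisms.
Variables (k : fieldType) (A E : nzRingType).
Variables (sc : ps k -> A -> A) (sce : ps k -> E -> E).
Hypotheses (Halg : kh_algebra sc) (Ealg : kh_algebra sce).

(** Compatibility with constants and powers of [h] suffices to carry an h-adic sum of terms in [A]
    to the corresponding sum in [E]. *)
Record kh_morphism (rho : A -> E) : Prop := {
  rhoD : {morph rho : a b / a + b};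
  rhoM : {morph rho : a b / a * b};
  rho_emb : forall c, rho (embA sc c) = embA sce c;
  rho_hpow : forall N a, rho (sc (hpow k N) a) = sce (hpow k N) (rho a)
}.

Section Theory.
Variable rho : A -> E.
Hypothesis rhoP : kh_morphism rho.

Lemma rho0 : rho 0 = 0.
Proof. by apply: (addrI (rho 0)); rewrite -(rhoD rhoP) !addr0. Qed.
Lemma rhoN a : rho (- a) = - rho a.
Proof. by apply: (addrI (rho a)); rewrite -(rhoD rhoP) !subrr rho0. Qed.
Lemma rhoB a b : rho (a - b) = rho a - rho b.
Proof. by rewrite (rhoD rhoP) rhoN. Qed.
Lemma rho_sum I (r : seq I) (P : pred I) (F : I -> A) :
  rho (\sum_(i <- r | P i) F i) = \sum_(i <- r | P i) rho (F i).
Proof.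
by elim/big_rec2: _ => [|i y1 y2 _ <-]; rewrite ?rho0 ?(rhoD rhoP).
Qed.

Lemma rho_evA x y z t :
  rho (evA sc x y z t) = evA sce (rho x) (rho y) (rho z) t.
Proof.
elim: t => //= [c|t1 IH1 t2 IH2|t1 IH1 t2 IH2]; rewrite /evA /=.
- exact: rho_emb rhoP c.
- by rewrite (rhoD rhoP) -!/(evA _ _ _ _ _) IH1 IH2.
- by rewrite (rhoM rhoP) -!/(evA _ _ _ _ _) IH1 IH2.
Qed.

Lemma rho_in_hNA N a : in_hNA sc N a -> in_hNA sce N (rho a).
Proof. by case=> b ->; exists (rho b); rewrite (rho_hpow rhoP). Qed.

Lemma rho_hsums x y z u a : hsums sc (ser sc x y z u) a ->
  hsums sce (ser sce (rho x) (rho y) (rho z) u) (rho a).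
Proof.
move=> ha N; have := rho_in_hNA (ha N); congr in_hNA.
rewrite rhoB rho_sum; congr (_ - _); apply: eq_bigr => i _.
by rewrite /ser (rho_hpow rhoP) rho_evA.
Qed.

Lemma rho_a_rel x y z : a_rel x y z -> a_rel (rho x) (rho y) (rho z).
Proof.
case=> e1 e2; split.
  by rewrite -!(rhoM rhoP) -rhoB e1 !mulr2n (rhoD rhoP).
by rewrite -!(rhoM rhoP) -rhoB e2 !mulr2n rhoN (rhoD rhoP).
Qed.

Lemma rho_sl2_rel x y z : sl2_rel x y z -> sl2_rel (rho x) (rho y) (rho z).
Proof.
case=> e1 e2; split; first exact: rho_a_rel.
by rewrite -!(rhoM rhoP) -rhoB e2.
Qed.

End Theory.

(** Write [a] as a series of terms in [x], [y], [z] and sum the same series at [x'], [y'], [z']: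
    completeness gives a sum, separation makes it unique, and the last hypothesis makes it
    independent of the series. *)
Lemma kh_morphism_extension (x y z : A) (x' y' z' : E) :
  hadic_separated sce -> hadic_complete sce ->
  (forall a, exists u, hsums sc (ser sc x y z u) a) ->
  (forall u v a T, hsums sc (ser sc x y z u) a -> hsums sc (ser sc x y z v) a ->
    hsums sce (ser sce x' y' z' u) T -> hsums sce (ser sce x' y' z' v) T) ->
  exists rho, [/\ kh_morphism rho, rho x = x', rho y = y' & rho z = z'].
Proof.
move=> sep comp surj wd.
have /choice[rho rhoP] a : exists T, exists u,
    hsums sc (ser sc x y z u) a /\ hsums sce (ser sce x' y' z' u) T.
  have [u hu] := surj a.
  by have [T hT] := comp (fun m => evA sce x' y' z' (u m)); exists T, u.
(* Any series for [a] computes [rho a], so each compatibility below only takes one suitable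
   series. *)
have rhoU u a T : hsums sc (ser sc x y z u) a ->
    hsums sce (ser sce x' y' z' u) T -> rho a = T.
  move=> hu hT; have [v [hv hT']] := rhoP a.
  exact: (hsums_inj Ealg sep hT') (wd _ _ _ _ hu hv hT).
have rho_ev t : rho (evA sc x y z t) = evA sce x' y' z' t.
  exact: rhoU (ser_const Halg x y z t) (ser_const Ealg x' y' z' t).
exists rho; split.
- split=> [a b|a b|c|N a].
  + have [[u [hu hT]] [v [hv hS]]] := (rhoP a, rhoP b).
    exact: rhoU (ser_add Halg hu hv) (ser_add Ealg hT hS).
  + have [[u [hu hT]] [v [hv hS]]] := (rhoP a, rhoP b).
    exact: rhoU (ser_cauchy Halg hu hv) (ser_cauchy Ealg hT hS).
  + exact: rho_ev (TC c).
  + elim: N => [|N IH]; first by rewrite !sc1.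
    rewrite (hpowD k 1 N) -!scA // -IH.
    have [u [hu hT]] := rhoP (sc (hpow k N) a).
    exact: rhoU (ser_shift Halg hu) (ser_shift Ealg hT).
- exact: rho_ev (TH k).
- exact: rho_ev (TXm k).
- exact: rho_ev (TXp k).
Qed.

Lemma intertwine_ev (D x y z x' y' z' : E) t :
  D * x = x' * D -> D * y = y' * D -> D * z = z' * D ->
  D * evA sce x y z t = evA sce x' y' z' t * D.
Proof.
move=> ex ey ez; elim: t => //= [c|t1 IH1 t2 IH2|t1 IH1 t2 IH2]; rewrite /evA /=.
- by rewrite embAE // scMr // mulr1.
- by rewrite mulrDr mulrDl -!/(evA _ _ _ _ _) IH1 IH2.
- by rewrite mulrA -!/(evA _ _ _ _ _) IH1 -mulrA IH2 mulrA.
Qed.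

(** Commutation with the three generators extends to all series. [D] will be a diagonal rescaling of
    the basis, or the shift embedding one Verma module in another. *)
Lemma intertwine_hsums (D x y z x' y' z' T T' : E) u : hadic_separated sce ->
  D * x = x' * D -> D * y = y' * D -> D * z = z' * D ->
  hsums sce (ser sce x y z u) T -> hsums sce (ser sce x' y' z' u) T' ->
  D * T = T' * D.
Proof.
move=> sep ex ey ez hT hT'.
apply: (hsums_inj Ealg sep (hsumsMl Ealg D hT)).
apply: hsums_ext (hsumsMr Ealg D hT') => m.
by rewrite /ser scMl // scMr // (intertwine_ev _ ex ey ez).
Qed.

End Morphisms.

(** * Separation and completeness of topologically free algebras *)

Section TopFree.
Variables (k : fieldType) (A : nzRingType) (sc : ps k -> A -> A).
Hypotheses (Halg : kh_algebra sc) (free : top_free sc).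

Lemma psscale_hpow (V0 : lmodType k) N (v : nat -> V0) m :
  psscale (hpow k N) v m = if (m < N)%N then 0 else v (m - N)%N.
Proof.
rewrite /psscale; case: ltnP => le_Nm.
  rewrite big1 // => i _; rewrite /hpow ifN ?scale0r //.
  by have := ltn_ord i; lia.
rewrite (bigD1 (Ordinal (n := m.+1) (m := N) le_Nm)) //=.
rewrite /hpow eqxx scale1r big1 ?addr0 // => i ne_i.
by rewrite ifN ?scale0r //; apply: contraNneq ne_i => e; apply/eqP/val_inj.
Qed.

Lemma top_free_separated : hadic_separated sc.
Proof.
have [V0 [phi [[phi' phiK phi'K] [phiD phiZ]]]] := free.
have phi0 : phi (fun=> 0) = 0.
  apply: (addrI (phi (fun=> 0))); rewrite -phiD [RHS]addr0; congr phi.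
  by apply: funext => m; rewrite addr0.
move=> a ha; rewrite -[a]phi'K -phi0; congr phi; apply: funext => m.
have [b ->] := ha m.+1.
by rewrite -[b]phi'K -phiZ phiK psscale_hpow ltnS leqnn.
Qed.

Lemma top_free_complete : hadic_complete sc.
Proof.
have [V0 [phi [[phi' phiK phi'K] [phiD phiZ]]]] := free.
have phi0 : phi (fun=> 0) = 0.
  apply: (addrI (phi (fun=> 0))); rewrite -phiD [RHS]addr0; congr phi.
  by apply: funext => m; rewrite addr0.
have phi_sum N (F : nat -> nat -> V0) :
    \sum_(i < N) phi (F i) = phi (fun m => \sum_(i < N) F i m).
  elim: N => [|N IH].
    rewrite big_ord0 -phi0; congr phi; apply: funext => m; by rewrite big_ord0.
  rewrite big_ord_recr /= IH -phiD; congr phi; apply: funext => m.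
  by rewrite big_ord_recr.
move=> c; pose w m := phi' (c m).
exists (phi (fun M => \sum_(m < M.+1) w m (M - m)%N)) => N.
(* The remainder divided by [h^N] is the sum attached to the tail of [c]. *)
exists (phi (fun M => \sum_(m < M.+1) w (N + m)%N (M - m)%N)).
have -> : \sum_(m < N) sc (hpow k m) (c m) =
          \sum_(m < N) phi (psscale (hpow k m) (w m)).
  by apply: eq_bigr => m _; rewrite phiZ phi'K.
apply/eqP; rewrite (phi_sum N (fun m => psscale (hpow k m) (w m))) -phiZ.
rewrite subr_eq -phiD; apply/eqP; congr phi.
apply: funext => M; rewrite psscale_hpow.
have -> : \sum_(i < N) psscale (hpow k i) (w i) M =
          \sum_(i < N) if (M < i)%N then 0 else w i (M - i)%N.
  by apply: eq_bigr => i _; rewrite psscale_hpow.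
case: ltnP => [lt_MN|le_NM].
  rewrite add0r -(subnKC lt_MN) big_split_ord /= [X in _ + X]big1 ?addr0.
    by apply: eq_bigr => i _; rewrite ltnNge -ltnS ltn_ord.
  by move=> i _; rewrite ifT //; lia.
have eM : M.+1 = (N + (M - N).+1)%N by lia.
rewrite -(big_mkord xpredT (fun m => w m (M - m)%N)) eM big_mkord.
rewrite big_split_ord /= addrC; congr (_ + _).
  by apply: eq_bigr => i _; rewrite subnDA.
by apply: eq_bigr => i _; rewrite ifN //; have := ltn_ord i; lia.
Qed.

End TopFree.

(** * Weight operators *)

Section Hadic.
Variable k : fieldType.
Implicit Types (S T : endv k) (v w : vec k).
Notation sce := (@endvscale k).

Lemma in_hNA_coef N T v i M : in_hNA sce N T -> (M < N)%N -> T v i M = 0.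
Proof. by move=> [S ->] lt_MN; rewrite /= vecEZ hpowME lt_MN. Qed.

Lemma endv_separated : hadic_separated sce.
Proof.
move=> T hT; apply: endvP => v; apply: funext => i; apply: funext => M.
exact: in_hNA_coef (hT M.+1) (ltnSn M).
Qed.

Lemma hsums_coef (s : nat -> endv k) T v i M N : hsums sce s T -> (M < N)%N ->
  T v i M = \sum_(m < N) s m v i M.
Proof.
move=> hT lt_MN; have /eqP := in_hNA_coef v i (hT N) lt_MN.
by rewrite endvEB vecEB psEB endvEsum vecEsum psEsum subr_eq0 => /eqP.
Qed.

Lemma ser_coef x y z u T v i M : hsums sce (ser sce x y z u) T ->
  T v i M = \sum_(m < M.+1) evA sce x y z (u m) v i (M - m)%N.
Proof.
move=> hT; rewrite (hsums_coef v i hT (ltnSn M)); apply: eq_bigr => m _.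
by rewrite /ser /= vecEZ hpowME ltnNge -ltnS ltn_ord.
Qed.

Lemma endv_complete : hadic_complete sce.
Proof.
move=> c.
pose L (c : nat -> endv k) v : vec k :=
  fun i M => \sum_(m < M.+1) c m v i (M - m)%N.
(* Each coefficient of [L] is one of a finite sum of series, of any length beyond [M]; there
   linearity is a ring identity. *)
have LE c1 v i M N : (M < N)%N ->
    L c1 v i M = (\sum_(m < N) hpow k m * c1 m v i) M.
  move=> lt_MN; rewrite psEsum -(subnKC lt_MN) big_split_ord /=.
  rewrite [X in _ + X]big1 => [|j _]; last by rewrite hpowME ifT //; lia.
  rewrite addr0; apply: eq_bigr => j _.
  by rewrite hpowME ltnNge -ltnS ltn_ord.
have Llin c1 f u v : L c1 (f *: u + v) = f *: L c1 u + L c1 v.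
  apply: funext => i; apply: funext => M.
  rewrite vecED psED vecEZ psEM !(LE _ _ _ M M.+1) //.
  rewrite (@psmul_eqr _ _ _ (\sum_(m < M.+1) hpow k m * c1 m u i)); last first.
    by move=> j le_jM; rewrite (LE _ _ _ j M.+1).
  rewrite -psEM -psED mulr_sumr -big_split /=.
  apply: (congr1 (fun g : ps k => g M)); apply: eq_bigr => m _.
  rewrite elin vecED vecEZ mulrDr; congr (_ + _).
  by rewrite mulrCA.
exists (Endv (Llin c)) => N; exists (Endv (Llin (fun m => c (N + m)%N))).
apply: endvP => v; apply: funext => i; apply: funext => M.
rewrite endvEB vecEB psEB endvEsum vecEsum psEsum /= vecEZ hpowME.
apply/eqP; rewrite subr_eq; apply/eqP.
have -> : \sum_(m < N) endvscale (hpow k m) (c m) v i M =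
          (\sum_(m < N) hpow k m * c m v i) M by rewrite psEsum.
case: ltnP => [lt_MN|le_NM]; first by rewrite add0r (LE _ _ _ _ N).
rewrite (LE _ _ _ _ (N + (M - N).+1)%N); last by lia.
rewrite big_split_ord /= psED addrC; congr (_ + _).
rewrite (LE _ _ _ _ (M - N).+1) // !psEsum; apply: eq_bigr => m _.
rewrite !hpowME subnDA; have := ltn_ord m => lt_m.
by case: ltnP => h1; case: ltnP => h2 //; lia.
Qed.

Program Definition diagv (d : nat -> ps k) := @Endv k (fun v i => d i * v i) _.
Next Obligation.
by apply: funext => i; rewrite !vecED !vecEZ mulrDr mulrCA.
Qed.
Program Definition lowerv (f : nat -> ps k) :=
  @Endv k (fun v i => if i is i'.+1 then f i' * v i' else 0) _.
Next Obligation.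
apply: funext => -[|i]; rewrite !vecED !vecEZ; first by rewrite mulr0 addr0.
by rewrite mulrDr mulrCA.
Qed.
Program Definition raisev (e : nat -> ps k) :=
  @Endv k (fun v i => e i * v i.+1) _.
Next Obligation.
by apply: funext => i; rewrite !vecED !vecEZ mulrDr mulrCA.
Qed.
Program Definition shiftv (N : nat) :=
  @Endv k (fun v i => if (i < N)%N then 0 else v (i - N)%N) _.
Next Obligation.
apply: funext => i; rewrite !vecED !vecEZ; case: ifP => // _.
by rewrite mulr0 addr0.
Qed.

Definition mu (n : int) (i : nat) : k := (n - (2 * i)%N%:Z)%:~R.
Definition weightv n := diagv (fun i => pscst (mu n i)).

Lemma muE n i : mu n i = n%:~R - 2 * i%:R.
Proof. by rewrite /mu rmorphB /= -pmulrn natrM. Qed.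

(** Recasts [V_h(n, psi)] as three elements of the operator algebra, so that [hsums] and the
    intertwining lemmas apply to it. *)
Lemma evA_tact (psi : nat -> int -> ps k) n t v :
  evA sce (weightv n) (lowerv (fun=> 1)) (raisev (fun i => psi i.+1 n)) t v =
  tact psi n t v.
Proof.
elim: t v => //= [c|||t1 IH1 t2 IH2|t1 IH1 t2 IH2] v; rewrite /evA /=.
- by apply: funext => i; apply: funext => m; rewrite vecEZ pscstME.
- by apply: funext => i; apply: funext => m; rewrite pscstME.
- by apply: funext => -[|i] //; rewrite mul1r.
- by apply: funext => i; apply: funext => m; rewrite -IH1 -IH2.
- by rewrite -IH1 -IH2.
Qed.

Lemma actUh_ser (psi : nat -> int -> ps k) n u T j i M :
  hsums sce (ser sce (weightv n) (lowerv (fun=> 1))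
    (raisev (fun i => psi i.+1 n)) u) T ->
  actUh psi n u j i M = T (bvec k j) i M.
Proof.
move=> hT; rewrite (ser_coef _ _ _ hT); apply: eq_bigr => m _.
by rewrite evA_tact.
Qed.

Lemma weight_lowerv n f :
  weightv n * lowerv f - lowerv f * weightv n = - (lowerv f *+ 2).
Proof.
apply: endvP => v; apply: funext => i.
rewrite endvEB vecEB !endvEM endvEN vecEN mulr2n endvED vecED /=.
case: i => [|i]; first by rewrite mulr0 subr0 addr0 oppr0.
have -> : mu n i.+1 = mu n i - 1 - 1 by rewrite !muE -natr1; ring.
by rewrite !pscstD pscstN pscst1; ring.
Qed.

Lemma weight_raisev n e :
  weightv n * raisev e - raisev e * weightv n = raisev e *+ 2.
Proof.
apply: endvP => v; apply: funext => i.
rewrite endvEB vecEB !endvEM mulr2n endvED vecED /=.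
have -> : mu n i.+1 = mu n i - 1 - 1 by rewrite !muE -natr1; ring.
by rewrite !pscstD pscstN pscst1; ring.
Qed.

(** The classical coefficient in [X^+ b_(i+1) = (i+1)(n-i) b_i]; it is the value prescribed by (C1)
    for [psi^(i+1)(n)] at [h = 0]. *)
Definition vermac n i : k := i.+1%:R * (n%:~R - i%:R).
Definition vermav n := raisev (fun i => pscst (vermac n i)).

Lemma sl2_rel_verma n : sl2_rel (weightv n) (lowerv (fun=> 1)) (vermav n).
Proof.
split; first by split; rewrite ?weight_raisev ?weight_lowerv.
apply: endvP => v; apply: funext => i; rewrite endvEB vecEB !endvEM /=.
rewrite /vermac muE; case: i => [|i].
  by rewrite !subr0 mulr0 subr0 !mul1r.
rewrite !mul1r -mulrBl -pscstN -pscstD; congr (pscst _ * _).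
by rewrite -!natr1; ring.
Qed.

Lemma bvecE j i : bvec k j i = if i == j then 1 else 0.
Proof. by []. Qed.

Hypothesis char0 : [pchar k] =i pred0.

Lemma natr_eq0_char0 n : (n%:R == 0 :> k) = (n == 0)%N.
Proof. by have /pcharf0P := char0. Qed.

Lemma natr_inj_char0 : injective (fun n => n%:R : k).
Proof.
move=> m n; wlog le_nm : m n / (n <= m)%N => [IH|].
  by have [/IH|/ltnW/IH h e] := leqP n m; [apply | symmetry; apply: h].
move/eqP; rewrite -subr_eq0 -natrB // natr_eq0_char0 subn_eq0 => le_mn.
by apply/eqP; rewrite eqn_leq le_mn.
Qed.

Lemma mu_inj n : injective (mu n).
Proof.
move=> i j; rewrite !muE => /addrI /oppr_inj /mulfI h; apply: natr_inj_char0.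
by apply: h; rewrite natr_eq0_char0.
Qed.

(* Entry [i] of [T v] is an eigenfunctional of the transpose of the weight
   operator, so it only sees the coordinates of [v] of weight [c]. *)
Lemma weight_support n c T i w :
  (forall v, T (weightv n v) i = pscst c * T v i) ->
  (forall j, mu n j = c -> w j = 0) -> T w i = 0.
Proof.
(* [v] is a preimage of [w] under [weightv n - c]; where [mu n j = c] the inverse is [0] by
   convention, and [w j] vanishes there too. *)
move=> eigT w0; pose v : vec k := fun j => pscst (mu n j - c)^-1 * w j.
have -> : w = weightv n v - pscst c *: v.
  apply: funext => j; rewrite vecEB vecEZ /= /v !mulrA -mulrBl.
  rewrite -!pscstM -pscstN -pscstD -mulrBl.
  have [e|ne] := eqVneq (mu n j) c; first by rewrite w0 // mulr0.
  by rewrite divff ?subr_eq0 // pscst1 mul1r.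
by rewrite evB evZ vecEB vecEZ eigT subrr.
Qed.

Lemma bvec_support j v : (v - v j *: bvec k j) j = 0.
Proof. by rewrite vecEB vecEZ bvecE eqxx mulr1 subrr. Qed.

(** In characteristic zero the weights [mu n i] are distinct, so coordinate [i + 1] of [T v] can
    only depend on coordinate [i] of [v]. *)
Lemma weight_lower n T : weightv n * T - T * weightv n = - (T *+ 2) ->
  T = lowerv (fun i => T (bvec k i) i.+1).
Proof.
move=> wT; have eigT i v :
    T (weightv n v) i = pscst (mu n i + 1 + 1) * T v i.
  move/(congr1 (fun S : endv k => S v i)): wT.
  rewrite endvEB vecEB !endvEM endvEN vecEN mulr2n endvED vecED /=.
  rewrite !pscstD pscst1 => /eqP; rewrite subr_eq => /eqP e.
  have -> : (T (fun i0 => pscst (mu n i0) * v i0)) i =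
            pscst (mu n i) * T v i + (T v i + T v i) by rewrite e; ring.
  ring.
apply: endvP => v; apply: funext => -[|i] /=.
  (* Coordinate [0] would have to come from weight [n + 2], which does not occur. *)
  apply: (weight_support (eigT 0%N)) => j /eqP; rewrite !muE -subr_eq0.
  have -> : n%:~R - 2 * j%:R - (n%:~R - 2 * 0%:R + 1 + 1) = - (2 * j.+1%:R) :> k.
    by rewrite -natr1; ring.
  by rewrite oppr_eq0 mulf_eq0 !natr_eq0_char0.
have eT : mu n i.+1 + 1 + 1 = mu n i by rewrite !muE -natr1; ring.
have := eigT i.+1; rewrite eT => eig.
have := weight_support (w := v - v i *: bvec k i) eig.
rewrite evB evZ vecEB vecEZ => /(_ _)/eqP; rewrite subr_eq0 mulrC => h.
by apply/eqP/h => j /mu_inj ->; apply: bvec_support.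
Qed.

Lemma weight_raise n T : weightv n * T - T * weightv n = T *+ 2 ->
  T = raisev (fun i => T (bvec k i.+1) i).
Proof.
move=> wT; have eigT i v :
    T (weightv n v) i = pscst (mu n i.+1) * T v i.
  move/(congr1 (fun S : endv k => S v i)): wT.
  rewrite endvEB vecEB !endvEM mulr2n endvED vecED /=.
  have -> : mu n i.+1 = mu n i - 1 - 1 by rewrite !muE -natr1; ring.
  rewrite !pscstD pscstN pscst1 => /eqP; rewrite subr_eq => /eqP e.
  rewrite !mulrBl e /=; ring.
apply: endvP => v; apply: funext => i /=.
have := weight_support (w := v - v i.+1 *: bvec k i.+1) (eigT i).
rewrite evB evZ vecEB vecEZ => /(_ _)/eqP; rewrite subr_eq0 mulrC => h.
by apply/eqP/h => j /mu_inj ->; apply: bvec_support.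
Qed.

End Hadic.

(** * PBW normal form and Verma modules *)

Section PBW.
Variable k : fieldType.
Notation mono := (nat * {poly k} * nat)%type.
Implicit Types (L : seq mono) (p : {poly k}).

Section Evaluation.
Variables (C : algType k) (H F E : C).
Hypothesis rel : sl2_rel H F E.
Notation "p .[H]" := (horner_alg H p) (at level 2, format "p .[H]").

Definition pbw_mono (a b : nat) p : C := F ^+ a * p.[H] * E ^+ b.
Definition pbw L : C := \sum_(x <- L) pbw_mono x.1.1 x.2 x.1.2.

Lemma pbw_monoD a b p q : pbw_mono a b (p + q) = pbw_mono a b p + pbw_mono a b q.
Proof. by rewrite /pbw_mono rmorphD /= mulrDr mulrDl. Qed.

Lemma relHF p : p.[H] * F = F * (p \Po ('X - 2)).[H].
Proof.
have [[_ /eqP]] := rel; rewrite subr_eq => /eqP eHF _.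
have HF : H * F = F * (H - 2).
  by rewrite eHF mulrBr mulr_natr addrC.
elim/poly_ind: p => [|p c IH]; first by rewrite comp_poly0 rmorph0 mulr0 mul0r.
rewrite comp_polyD comp_polyM comp_polyX comp_polyC !rmorphD !rmorphM /=.
rewrite rmorphB /= rmorph_nat !horner_algC horner_algX mulrDr mulrDl; congr (_ + _).
  by rewrite -mulrA HF !mulrA IH.
by rewrite -scalerAr mulr1 -scalerAl mul1r.
Qed.

Lemma relEH p : E * p.[H] = (p \Po ('X - 2)).[H] * E.
Proof.
have [[/eqP]] := rel; rewrite subr_eq => /eqP eHE _ _.
have EH : E * H = (H - 2) * E.
  by rewrite mulrBl eHE mulr_natl addrAC subrr add0r.
elim/poly_ind: p => [|p c IH]; first by rewrite comp_poly0 rmorph0 mulr0 mul0r.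
rewrite comp_polyD comp_polyM comp_polyX comp_polyC !rmorphD !rmorphM /=.
rewrite rmorphB /= rmorph_nat !horner_algC horner_algX mulrDr mulrDl; congr (_ + _).
  by rewrite mulrA IH -!mulrA EH.
by rewrite -scalerAr mulr1 -scalerAl mul1r.
Qed.

Lemma relHFX a : H * F ^+ a = F ^+ a * ('X - (2 * a)%:R).[H].
Proof.
elim: a => [|a IH].
  by rewrite !expr0 muln0 subr0 mul1r mulr1 horner_algX.
rewrite !exprSr mulrA IH -!mulrA relHF; congr (_ * (_ * horner_alg _ _)).
rewrite comp_polyB comp_polyX rmorph_nat /= mulnS natrD.
by ring.
Qed.

(** The classical formula for the commutator of [E] and [F^a], by induction on [a]. At [a = 0] the
    factor [a%:R] makes the truncated [a.-1] harmless. *)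
Lemma relEF a :
  E * F ^+ a = F ^+ a * E + F ^+ a.-1 * (a%:R * ('X - a.-1%:R)).[H].
Proof.
have [_ /eqP] := rel; rewrite subr_eq => /eqP eEF.
elim: a => [|a IH].
  by rewrite !expr0 !rmorphM /= !rmorph_nat mul0r mulr0 addr0 mul1r mulr1.
rewrite exprSr mulrA IH mulrDl -(mulrA (F ^+ a) E) eEF mulrDr.
rewrite (addrC (F ^+ a * H)) -addrA -(mulrA (F ^+ a.-1)) relHF (mulrA _ F E).
congr (_ + _).
case: a {IH} => [|a] /=.
  by rewrite mulr0n subr0 mul0r comp_poly0 rmorph0 !mulr0 addr0 !mul1r horner_algX.
have -> : F ^+ a.+1 * H = F ^+ a.+1 * horner_alg H 'X by rewrite horner_algX.
rewrite (mulrA (F ^+ a)) -exprSr -mulrDr -rmorphD /=.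
congr (_ * horner_alg _ _).
rewrite comp_polyM comp_polyB comp_polyX !rmorph_nat /= -!natr1.
ring.
Qed.

Definition pbw_mulH (x : mono) : mono :=
  (x.1.1, ('X - (2 * x.1.1)%:R) * x.1.2, x.2).
Definition pbw_mulF (x : mono) : mono := (x.1.1.+1, x.1.2, x.2).
Definition pbw_mulE (x : mono) : seq mono :=
  [:: (x.1.1, x.1.2 \Po ('X - 2), x.2.+1);
      (x.1.1.-1, x.1.1%:R * ('X - x.1.1.-1%:R) * x.1.2, x.2)].

Lemma pbw_mulHE L : H * pbw L = pbw (map pbw_mulH L).
Proof.
rewrite /pbw big_map mulr_sumr; apply: eq_bigr => x _.
by rewrite /pbw_mono !mulrA relHFX rmorphM /= !mulrA.
Qed.

Lemma pbw_mulFE L : F * pbw L = pbw (map pbw_mulF L).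
Proof.
rewrite /pbw big_map mulr_sumr; apply: eq_bigr => x _.
by rewrite /pbw_mono !mulrA -exprS.
Qed.

Lemma pbw_mulEE L : E * pbw L = pbw (flatten (map pbw_mulE L)).
Proof.
rewrite /pbw big_flatten big_map mulr_sumr; apply: eq_bigr => x _.
rewrite /pbw_mulE !big_cons big_nil /= addr0 /pbw_mono !mulrA relEF.
rewrite !mulrDl; congr (_ + _).
  by rewrite -(mulrA _ E) relEH exprS !mulrA.
by rewrite [horner_alg H (_ * _ * _)]rmorphM /= !mulrA.
Qed.

Lemma pbw_scale c L : c%:A * pbw L = pbw (map (fun x => (x.1.1, c *: x.1.2, x.2)) L).
Proof.
rewrite /pbw big_map mulr_sumr; apply: eq_bigr => x _.
rewrite -scalerAl mul1r /pbw_mono -mul_polyC rmorphM /= horner_algC.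
by rewrite -[c%:A * _]scalerAl mul1r -scalerAr -scalerAl.
Qed.

End Evaluation.

(** Left multiplication by a generator sends normal forms to normal forms, so a term can be applied
    to the normal form of [1]. The list is chosen before the algebra, so that what Verma modules
    reveal about it holds in every [C]. *)
Lemma pbw_spanning t : exists L, forall (C : algType k) (H F E : C),
  sl2_rel H F E -> teval (fun c => c%:A) H F E t = pbw H F E L.
Proof.
suff [L LP] : exists L', forall (C : algType k) (H F E : C), sl2_rel H F E ->
    teval (fun c => c%:A) H F E t * pbw H F E [:: (0, 1, 0)] = pbw H F E L'.
  exists L => C H F E rel; rewrite -LP // /pbw big_seq1 /pbw_mono /=.
  by rewrite rmorph1 !mulr1.
elim: t [:: (0, 1, 0)] => [c|||||].
- by move=> L; eexists => C H F E _; apply: pbw_scale.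
- by move=> L; eexists => C H F E rel; apply: pbw_mulHE.
- by move=> L; eexists => C H F E rel; apply: pbw_mulFE.
- by move=> L; eexists => C H F E rel; apply: pbw_mulEE.
- move=> t1 IH1 t2 IH2 L; have [[L1 P1] [L2 P2]] := (IH1 L, IH2 L).
  exists (L1 ++ L2) => C H F E rel /=.
  by rewrite mulrDl P1 // P2 // /pbw big_cat.
- move=> t1 IH1 t2 IH2 L; have [L2 P2] := IH2 L; have [L1 P1] := IH1 L2.
  by exists L1 => C H F E rel /=; rewrite -mulrA P2 // P1.
Qed.

Definition pbw_coef L a b : {poly k} :=
  \sum_(x <- L | (x.1.1 == a) && (x.2 == b)) x.1.2.
Definition pbw_bound L : nat := \max_(x <- L) (maxn x.1.1 x.2).+1.

(** Stated for any additive [G] so that evaluation in an algebra and matrix entries on Verma modules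
    are sorted by the same coefficients [pbw_coef]. *)
Lemma pbw_collect (V : zmodType) (G : nat -> nat -> {poly k} -> V) L :
  (forall a b, {morph G a b : p q / p + q}) ->
  \sum_(x <- L) G x.1.1 x.2 x.1.2 =
  \sum_(a < pbw_bound L) \sum_(b < pbw_bound L) G a b (pbw_coef L a b).
Proof.
move=> GD; have G0 a b : G a b 0 = 0.
  by apply: (addrI (G a b 0)); rewrite -GD !addr0.
(* The bound changes along the list, so the induction is run for all larger bounds. *)
have: forall N, (pbw_bound L <= N)%N -> \sum_(x <- L) G x.1.1 x.2 x.1.2 =
    \sum_(a < N) \sum_(b < N) G a b (pbw_coef L a b); last by apply.
rewrite /pbw_bound /pbw_coef; elim: L => [|[[a0 p] b0] L IH] N.
  move=> _; rewrite big_nil big1 // => a _; rewrite big1 // => b _.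
  by rewrite big_nil.
rewrite !big_cons geq_max /= => /andP[lt_N /IH ->].
have [lt_a lt_b] : (a0 < N)%N /\ (b0 < N)%N.
  by move: lt_N; rewrite gtn_max => /andP.
pose G1 (a b : nat) := if (a0 == a) && (b0 == b) then G a b p else 0.
have -> : G a0 b0 p = \sum_(a < N) \sum_(b < N) G1 a b.
  rewrite (bigD1 (Ordinal lt_a)) //= [X in _ + X]big1 ?addr0; last first.
    move=> a ne_a; rewrite big1 // => b _; rewrite /G1 ifN //.
    by apply: contraNN ne_a => /andP[/eqP e _]; apply/eqP/val_inj.
  rewrite (bigD1 (Ordinal lt_b)) //= [X in _ + X]big1 ?addr0.
    by rewrite /G1 !eqxx.
  move=> b ne_b; rewrite /G1 ifN //.
  by apply: contraNN ne_b => /andP[_ /eqP e]; apply/eqP/val_inj.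
rewrite -big_split; apply: eq_bigr => a _; rewrite -big_split.
apply: eq_bigr => b _; rewrite big_cons /G1 /=.
by case: ifP => _; rewrite ?GD ?add0r.
Qed.

Lemma pbwE (C : algType k) (H F E : C) L : pbw H F E L =
  \sum_(a < pbw_bound L) \sum_(b < pbw_bound L)
    pbw_mono H F E a b (pbw_coef L a b).
Proof. by apply: pbw_collect => a b p q; apply: pbw_monoD. Qed.

(** * Action of normal forms on Verma modules *)

Notation E := (endv k).
Notation kE := (kalg (endv_kh_algebra k)).

(** The coefficient of [b_(j-b)] in [E^b b_j] on the Verma module. It vanishes for [b > j], which
    makes the truncated [j - b] harmless. *)
Definition falling (n : int) (j b : nat) : k :=
  \prod_(s < b) ((j%:R - s%:R) * (n%:~R - j%:R + 1 + s%:R)).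

Lemma falling_eq0 n j b : (j < b)%N -> falling n j b = 0.
Proof.
by move=> lt_jb; rewrite /falling (bigD1 (Ordinal lt_jb)) //= subrr !mul0r.
Qed.

Lemma vermav_bvecX n j b : (vermav k n ^+ b) (bvec k j) =
  pscst (falling n j b) *: bvec k (j - b)%N.
Proof.
elim: b => [|b IH].
  by rewrite expr0 subn0 /falling big_ord0 pscst1 scale1r.
have fallingS : falling n j b.+1 =
    falling n j b * ((j%:R - b%:R) * (n%:~R - j%:R + 1 + b%:R)).
  by rewrite /falling big_ord_recr.
rewrite exprS endvEM IH evZ fallingS.
have [le_jb|lt_bj] := leqP j b.
  have -> : vermav k n (bvec k (j - b)%N) = 0.
    apply: funext => i; rewrite /= bvecE ifN ?mulr0 //.
    by rewrite (eqP (_ : (j - b == 0)%N)) // subn_eq0.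
  rewrite scaler0; have [e|ne] := eqVneq j b.
    by rewrite e subrr mul0r mulr0 pscst0 scale0r.
  by rewrite falling_eq0 ?mul0r ?pscst0 ?scale0r //; lia.
rewrite pscstM -scalerA; congr (_ *: _); apply: funext => i.
rewrite /= vecEZ !bvecE; have -> : (i.+1 == j - b)%N = (i == j - b.+1)%N by lia.
case: eqP => [->|_]; last by rewrite !mulr0.
rewrite !mulr1 /vermac; congr pscst; rewrite -!natr1 natrB // -natr1.
ring.
Qed.

Lemma lowerv1_bvecX j a : (lowerv (fun=> 1 : ps k) ^+ a) (bvec k j) =
  bvec k (j + a)%N.
Proof.
elim: a => [|a IH]; first by rewrite expr0 addn0.
rewrite exprS endvEM IH; apply: funext => -[|i] /=; rewrite !bvecE.
  by rewrite ifN // addnS.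
by rewrite mul1r addnS eqSS.
Qed.

Lemma weightv_bvec n j : weightv k n (bvec k j) = pscst (mu k n j) *: bvec k j.
Proof.
apply: funext => i; rewrite /= vecEZ bvecE.
by case: eqP => [->//|_]; rewrite !mulr0.
Qed.

Lemma horner_weightv_bvec n j p :
  (horner_alg (weightv k n : kE) p : E) (bvec k j) =
  pscst p.[mu k n j] *: bvec k j.
Proof.
elim/poly_ind: p => [|p c IH].
  by rewrite rmorph0 horner0 pscst0 scale0r.
rewrite rmorphD rmorphM /= horner_algX horner_algC hornerMXaddC.
rewrite weightv_bvec evZ IH.
by rewrite scalerA mulrC -pscstM pscstD scalerDl.
Qed.

(** The entry from [b_j] to [b_i]: [p(H)] acts on [b_(j-b)], of weight [n - 2j + 2b]. The weight
    avoids truncated subtraction and so is polynomial in [n] and [j]. *)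
Definition verma_coef L n j i : k :=
  \sum_(x <- L) if (j - x.2 + x.1.1 == i)%N
    then x.1.2.[n%:~R - 2 * j%:R + 2 * x.2%:R] * falling n j x.2 else 0.

Lemma pbw_verma L n j i :
  (pbw (weightv k n : kE) (lowerv (fun=> 1)) (vermav k n) L : E) (bvec k j) i =
  pscst (verma_coef L n j i).
Proof.
rewrite /pbw /verma_coef; elim: L => [|[[a p] b] L IH].
  by rewrite !big_nil pscst0.
rewrite !big_cons pscstD -IH [LHS]vecED; congr (_ + _).
rewrite /pbw_mono /=.
rewrite [LHS](_ : _ = (lowerv (fun=> 1 : ps k) ^+ a)
  ((horner_alg (weightv k n : kE) p : E) ((vermav k n ^+ b) (bvec k j))) i) //.
rewrite vermav_bvecX evZ horner_weightv_bvec !evZ lowerv1_bvecX scalerA -pscstM.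
rewrite vecEZ bvecE eq_sym; case: eqP => _; last by rewrite mulr0 pscst0.
rewrite mulr1 mulrC; congr pscst.
have [lt_jb|le_bj] := ltnP j b; first by rewrite falling_eq0 ?mulr0.
by congr (_.[_] * _); rewrite muE natrB //; ring.
Qed.

Lemma verma_evA t : exists L,
  (forall n j i, evA (@endvscale k) (weightv k n) (lowerv (fun=> 1)) (vermav k n)
    t (bvec k j) i = pscst (verma_coef L n j i)) /\
  (forall (C : algType k) (H F E : C), sl2_rel H F E ->
    teval (fun c => c%:A) H F E t = pbw H F E L).
Proof.
have [L LP] := pbw_spanning t; exists L; split=> // n j i.
rewrite -(@teval_kalg _ _ _ (endv_kh_algebra k)) LP; first exact: pbw_verma.
exact: sl2_rel_verma.
Qed.

(** * Faithfulness and polynomial entries in characteristic zero *)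

Hypothesis char0 : [pchar k] =i pred0.

Lemma poly_char0_eq0 p N : (forall n, (N <= n)%N -> p.[n%:R] = 0) -> p = 0.
Proof.
move=> p0; apply: (@roots_geq_poly_eq0 _ p (mkseq (fun i => (N + i)%:R) (size p))).
- by apply/allP => x /mapP[i _ ->]; apply/eqP/p0/leq_addr.
- rewrite map_inj_uniq ?iota_uniq // => i j /(natr_inj_char0 char0).
  by apply: addnI.
- by rewrite size_mkseq.
Qed.

Lemma falling_neq0 (n b : nat) : (b <= n)%N -> falling n%:Z b b != 0.
Proof.
move=> le_bn; apply/prodf_neq0 => s _; have lt_sb := ltn_ord s.
rewrite mulf_neq0 //; first by rewrite -natrB ?natr_eq0_char0 // 1?ltnW //; lia.
by rewrite -pmulrn -natrB // natr1 -natrD natr_eq0_char0.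
Qed.

(** Induction on [b], reading the entry from [b_b] to [b_a]. Larger powers of [E] kill [b_b],
    smaller ones have zero coefficients by induction, and at power [b] only [F^a] reaches [b_a].
    What remains is [p(n) * falling n b b = 0] for all [n >= b], so [p] has infinitely many
    roots. *)
Lemma verma_coef_eq0 L : (forall n j i, verma_coef L n j i = 0) ->
  forall (C : algType k) (H F E : C), pbw H F E L = 0.
Proof.
move=> L0 C H F E; rewrite pbwE big1 // => a _; rewrite big1 // => b _.
have -> : pbw_coef L a b = 0; last by rewrite /pbw_mono rmorph0 mulr0 mul0r.
case: b => b /=; elim/ltn_ind: b a => b IH a lt_b.
apply: (@poly_char0_eq0 _ b) => n le_bn.
have := L0 n%:Z b a; rewrite /verma_coef.
pose G a' b' (p : {poly k}) := if (b - b' + a' == a)%N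
  then p.[n%:~R - 2 * b%:R + 2 * b'%:R] * falling n%:Z b b' else 0.
rewrite -[LHS]/(\sum_(x <- L) G x.1.1 x.2 x.1.2) pbw_collect; last first.
  move=> a' b' p q; rewrite /G; case: ifP => _; rewrite ?addr0 //.
  by rewrite hornerD mulrDl.
rewrite (bigD1 a) //= [X in _ + X]big1 ?addr0; last first.
  move=> a' ne_a; rewrite big1 // => b' _; rewrite /G; case: eqP => // e.
  have [lt_b'|le_b'] := ltnP b' b; first by rewrite IH // horner0 mul0r.
  have [lt'|ge'] := ltnP b b'; first by rewrite falling_eq0 // mulr0.
  by case/eqP: ne_a; apply: val_inj => /=; lia.
rewrite (bigD1 (Ordinal lt_b)) //= [X in _ + X]big1 ?addr0; last first.
  move=> b' ne_b; rewrite /G; case: eqP => // e.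
  have [lt_b'|le_b'] := ltnP b' b; first by rewrite IH // horner0 mul0r.
  have [lt'|ge'] := ltnP b b'; first by rewrite falling_eq0 // mulr0.
  by case/eqP: ne_b; apply: val_inj => /=; lia.
rewrite /G subnn add0n eqxx => /eqP.
rewrite mulf_eq0 (negbTE (falling_neq0 le_bn)) orbF -pmulrn subrK.
by move/eqP.
Qed.

(** The normal form of [t - t'] has zero entries on every Verma module. These entries are constant
    series, so their coefficient at [h^0] decides. *)
Lemma verma_faithful t t' :
  (forall n j i,
    evA (@endvscale k) (weightv k n) (lowerv (fun=> 1)) (vermav k n)
      t (bvec k j) i 0%N =
    evA (@endvscale k) (weightv k n) (lowerv (fun=> 1)) (vermav k n)
      t' (bvec k j) i 0%N) ->
  sl2_eq t t'.
Proof.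
move=> eq_tt' C H F E rel.
have [L [LV LP]] := verma_evA (TAdd t (TMul (TC (-1)) t')).
apply/eqP; rewrite -subr_eq0 -mulN1r -[-1 : C]scaleN1r; apply/eqP.
rewrite -[LHS]/(teval _ _ _ _ (TAdd t (TMul (TC (-1)) t'))) LP //.
apply: verma_coef_eq0 => n j i.
have <- : pscst (verma_coef L n j i) 0%N = verma_coef L n j i by [].
pose V t := evA (@endvscale k) (weightv k n) (lowerv (fun=> 1)) (vermav k n)
  t (bvec k j).
rewrite -LV -[LHS]/((V t + pscst (-1) *: V t') i 0%N).
by rewrite vecED psED vecEZ pscstME mulN1r /V eq_tt' subrr.
Qed.

Lemma verma_coef_regular L : exists P : {poly {poly k}},
  forall (n : int) (j : nat), verma_coef L n j j = (P.[j.+1%:R%:P]).[n%:~R].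
Proof.
elim: L => [|[[a p] b] L [P PP]].
  by exists 0 => n j; rewrite /verma_coef big_nil !horner0.
have [->|ne_ab] := eqVneq a b; last first.
  exists P => n j; rewrite /verma_coef big_cons -/(verma_coef L n j j) PP /=.
  (* With [a] and [b] distinct, [j - b + a = j] forces [j < b] by truncation, and then [falling]
     vanishes. *)
  case: eqP => e; last by rewrite add0r.
  by rewrite falling_eq0 ?mulr0 ?add0r //; lia.
pose ev j (n : int) (Q : {poly {poly k}}) : k := (Q.[j.+1%:R%:P]).[n%:~R].
have evM j n Q Q' : ev j n (Q * Q') = ev j n Q * ev j n Q'.
  by rewrite /ev !hornerM.
have evD j n Q Q' : ev j n (Q + Q') = ev j n Q + ev j n Q'.
  by rewrite /ev !hornerD.
have evC j n c : ev j n c%:P%:P = c by rewrite /ev !hornerC.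
have [N evN] : exists N, forall j n, ev j n N = n%:~R.
  by exists ('X)%:P => j n; rewrite /ev hornerC hornerX.
(* The outer variable is the index [j + 1] of the colouring, hence ['X - 1]. *)
have [J evJ] : exists J, forall j n, ev j n J = j%:R.
  by exists ('X - 1) => j n; rewrite /ev hornerD hornerN !hornerE -natr1 addrK.
have [Q QP] : exists Q, forall j n, ev j n Q = p.[n%:~R - 2 * j%:R + 2 * b%:R].
  elim/poly_ind: {PP} p => [|p c [Q QP]].
    by exists 0 => j n; rewrite /ev !horner0.
  exists (Q * (N + (-2)%:P%:P * J + (2 * b%:R)%:P%:P) + c%:P%:P) => j n.
  by rewrite hornerMXaddC !(evD, evM, evC) QP evN evJ mulNr.
have [Q' QP'] : exists Q', forall j n, ev j n Q' = falling n j b.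
  rewrite /falling; elim: {Q QP} b => [|b [Q' QP']].
    by exists 1%:P%:P => j n; rewrite evC big_ord0.
  exists (Q' * ((J + (- b%:R)%:P%:P) *
    (N + (-1)%:P%:P * J + (1 + b%:R)%:P%:P))) => j n.
  by rewrite big_ord_recr /= !(evD, evM, evC) QP' evN evJ mulN1r addrA.
exists (Q * Q' + P) => n j.
rewrite /verma_coef big_cons -/(verma_coef L n j j) PP /= -!/(ev _ _ _).
rewrite evD evM QP QP'; congr (_ + _); case: eqP => // ne.
by rewrite falling_eq0 ?mulr0 //; lia.
Qed.

End PBW.

(** * The colouring of an h-trivial deformation *)

Section Bands.
Variable k : fieldType.
Notation sce := (@endvscale k).
Implicit Types (u : nat -> term k) (S T : endv k) (v w : vec k).

(** Only [X^+] reads a coordinate of higher index, and just the next one, so a term looks ahead by a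
    bounded amount. *)
Lemma evA_band n f e t : exists s, forall v i,
  (forall j, (j < i + s)%N -> v j = 0) ->
  evA sce (weightv k n) (lowerv f) (raisev e) t v i = 0.
Proof.
elim: t => [c||||t1 [s1 IH1] t2 [s2 IH2]|t1 [s1 IH1] t2 [s2 IH2]].
- exists 1%N => v i v0; rewrite /evA /= vecEZ v0 ?mulr0 //; lia.
- exists 1%N => v i v0; rewrite /evA /= v0 ?mulr0 //; lia.
- exists 1%N => v [|i] v0; rewrite /evA //= v0 ?mulr0 //; lia.
- exists 2%N => v i v0; rewrite /evA /= v0 ?mulr0 //; lia.
- exists (s1 + s2)%N => v i v0.
  by rewrite [LHS]vecED IH1 ?IH2 ?addr0 // => j lt_j; apply: v0; lia.
- exists (s1 + s2)%N => v i v0.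
  apply: IH1 => j lt_j; apply: IH2 => l lt_l; apply: v0; lia.
Qed.

Lemma ser_band n f e u T i M :
  hsums sce (ser sce (weightv k n) (lowerv f) (raisev e) u) T ->
  exists B, forall v, (forall j, (j < B)%N -> v j = 0) -> T v i M = 0.
Proof.
move=> hT; have /choice[s sP] m := evA_band n f e (u m).
exists (i + \sum_(m < M.+1) s m)%N => v v0.
rewrite (ser_coef _ _ _ hT) big1 // => m _; rewrite sP // => j lt_j.
by apply: v0; rewrite (bigD1 m) //=; lia.
Qed.

(** A single coefficient of a single coordinate of [T v] or [T' v] sees finitely many coordinates of
    [v], so [v] may be cut to a finite combination of the [bvec k j]. *)
Lemma ser_bvec_inj n f e u u' T T' :
  hsums sce (ser sce (weightv k n) (lowerv f) (raisev e) u) T ->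
  hsums sce (ser sce (weightv k n) (lowerv f) (raisev e) u') T' ->
  (forall j, T (bvec k j) = T' (bvec k j)) -> T = T'.
Proof.
move=> hT hT' eb; apply: endvP => v; apply: funext => i; apply: funext => M.
have [[B BP] [B' BP']] := (ser_band i M hT, ser_band i M hT').
pose w := \sum_(j < B + B') v j *: bvec k j.
have vw0 j : (j < B + B')%N -> (v - w) j = 0.
  move=> lt_j; rewrite vecEB /w vecEsum (bigD1 (Ordinal lt_j)) //=.
  rewrite big1 ?addr0 => [|l ne_l]; first by rewrite vecEZ bvecE eqxx mulr1 subrr.
  rewrite vecEZ bvecE ifN ?mulr0 //.
  by apply: contraNneq ne_l => e'; apply/eqP/val_inj.
have ew : T w = T' w by rewrite !ev_sum; apply: eq_bigr => j _; rewrite !evZ eb.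
rewrite -(subrK w v); move: (v - w) vw0 => r r0.
rewrite !evD ew !vecED !psED (BP r) ?(BP' r) // => j lt_j; apply: r0; lia.
Qed.

(** The rescaling of [b_i] under which lowering with entries [f] becomes lowering with entries
    [1]. *)
Definition partial_prods (f : nat -> ps k) i : ps k := \prod_(j < i) f j.

Lemma partial_prods_coef0 f i : (forall j, f j 0%N = 1) ->
  partial_prods f i 0%N = 1.
Proof.
move=> f1; rewrite /partial_prods; elim: i => [|i IH]; first by rewrite big_ord0.
by rewrite big_ord_recr /= psM0E IH f1 mulr1.
Qed.

Lemma diagv_bvec d j : diagv d (bvec k j) = d j *: bvec k j.
Proof.
apply: funext => i; rewrite /= vecEZ bvecE.
by case: eqP => [->//|_]; rewrite !mulr0.
Qed.

Lemma diagv_weightv d n : diagv d * weightv k n = weightv k n * diagv d.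
Proof. by apply: endvP => v; apply: funext => i /=; rewrite mulrCA. Qed.

Lemma diagv_lowerv f :
  diagv (partial_prods f) * lowerv (fun=> 1) = lowerv f * diagv (partial_prods f).
Proof.
apply: endvP => v; apply: funext => -[|i] /=; rewrite ?mulr0 // mul1r.
by rewrite /partial_prods big_ord_recr /=; ring.
Qed.

Lemma diagv_raisev f e e' : (forall i, e' i = e i * f i) ->
  diagv (partial_prods f) * raisev e' = raisev e * diagv (partial_prods f).
Proof.
move=> eE; apply: endvP => v; apply: funext => i /=.
by rewrite /partial_prods big_ord_recr /= eE; ring.
Qed.

Lemma diagv_regl d S T : (forall i, d i 0%N = 1) ->
  diagv d * S = diagv d * T -> S = T.
Proof.
move=> d1 eST; apply: endvP => v; apply: funext => i.
have := congr1 (fun U : endv k => U v i) eST; rewrite !endvEM /= => /eqP.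
rewrite -subr_eq0 -mulrBr => /eqP/psmul_eq0 /eqP.
by rewrite d1 oner_eq0 subr_eq0 => /(_ isT)/eqP.
Qed.

Lemma diagv_regr d S T j : (forall i, d i 0%N = 1) ->
  S (diagv d (bvec k j)) = T (diagv d (bvec k j)) -> S (bvec k j) = T (bvec k j).
Proof.
move=> d1; rewrite diagv_bvec !evZ => eST; apply: funext => i.
have := congr1 (fun v : vec k => v i) eST; rewrite !vecEZ => /eqP.
rewrite -subr_eq0 -mulrBr => /eqP/psmul_eq0 /eqP.
by rewrite d1 oner_eq0 subr_eq0 => /(_ isT)/eqP.
Qed.

Lemma shiftv_bvec N j : shiftv k N (bvec k j) = bvec k (N + j)%N.
Proof.
apply: funext => i; rewrite /= !bvecE; case: ltnP => [lt_iN|le_Ni].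
  by rewrite ifN //; lia.
by congr (if _ then _ else _); lia.
Qed.

(** The vector [b_(n+1)] of [V(n)] has weight [n - 2(n+1) = -n-2]. *)
Lemma shiftv_weightv (n : nat) :
  shiftv k n.+1 * weightv k (- n%:Z - 2) = weightv k n%:Z * shiftv k n.+1.
Proof.
apply: endvP => v; apply: funext => i /=; case: ltnP => [_|le_ni].
  by rewrite mulr0.
congr (pscst _ * _); rewrite !muE natrB // -natr1 rmorphB rmorphN /= -!pmulrn.
ring.
Qed.

Lemma shiftv_lowerv N :
  shiftv k N * lowerv (fun=> 1) = lowerv (fun=> 1) * shiftv k N.
Proof.
apply: endvP => v; apply: funext => -[|i] /=; rewrite ?mul1r.
  by case: ifP => //; case: N.
case: ltnP => [lt_iN|le_Ni]; first by rewrite ifT //; lia.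
have [e|ne_iN] := eqVneq i.+1 N; first by rewrite e subnn ifT //; lia.
by rewrite ifN ?subSn ?mul1r //; lia.
Qed.

(** [b_(n+1)] is singular in [V(n)] since [vermac k n n = 0]; beyond it,
    [(n+i+2)(-i-1) = (i+1)(-n-2-i)]. *)
Lemma shiftv_vermav (n : nat) :
  shiftv k n.+1 * vermav k (- n%:Z - 2) = vermav k n%:Z * shiftv k n.+1.
Proof.
apply: endvP => v; apply: funext => i /=; case: ltnP => [lt_in|le_ni].
  case: ltnP => [_|le_ni]; first by rewrite mulr0.
  have -> : i = n by lia.
  by rewrite /vermac -pmulrn subrr mulr0 pscst0 mul0r.
rewrite ifN ?subSn //; last by lia.
congr (pscst _ * _); rewrite /vermac -!natr1 natrB // -natr1.
rewrite rmorphB rmorphN /= -!pmulrn; ring.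
Qed.

(** Terms act on the classical Verma module by constant series, so the coefficient at [h^M] comes
    from [u M] alone. *)
Lemma ser_verma_coef n u L T j i M :
  hsums sce (ser sce (weightv k n) (lowerv (fun=> 1)) (vermav k n) u) T ->
  (forall m j i, evA sce (weightv k n) (lowerv (fun=> 1)) (vermav k n) (u m)
    (bvec k j) i = pscst (verma_coef (L m) n j i)) ->
  T (bvec k j) i M = verma_coef (L M) n j i.
Proof.
move=> hT LP; rewrite (ser_coef _ _ _ hT) (bigD1 ord_max) //= big1 ?addr0.
  by rewrite LP subnn.
move=> m ne_m; rewrite LP /pscst ifN // subn_eq0 -ltnNge.
by have := ltn_ord m; rewrite ltnS leq_eqVlt => /orP[/eqP e|//];
  case/eqP: ne_m; apply: val_inj.
Qed.

End Bands.

(** * The action of [A] on Verma modules, its colouring and the isomorphism *)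

Section Main.
Variables (k : fieldType) (A : nzRingType) (sc : ps k -> A -> A).
Variables (HA XmA XpA Fp Ep : A).
Hypotheses (char0 : [pchar k] =i pred0) (Halg : kh_algebra sc).
Hypothesis Hstruct : a_rel HA XmA XpA.
Hypothesis Hfree : top_free sc.
Hypothesis Hsl2 : sl2_rel HA Fp Ep.
Hypothesis surjFE : forall a, exists u, hsums sc (ser sc HA Fp Ep u) a.
Hypothesis injFE : forall u u', (exists a, hsums sc (ser sc HA Fp Ep u) a /\
  hsums sc (ser sc HA Fp Ep u') a) <-> (forall m, sl2_eq (u m) (u' m)).
Hypothesis congF : in_hNA sc 1 (Fp - XmA).
Hypothesis congE : in_hNA sc 1 (Ep - XpA).
Hypothesis surjX : forall a, exists u, hsums sc (ser sc HA XmA XpA u) a.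

Notation sce := (@endvscale k).
Let Ealg := endv_kh_algebra k.

(** By injectivity of [g], two series with the same sum in [A] agree termwise in [U(sl2)], hence on
    the Verma module. *)
Lemma verma_rho_exists n : exists rho : A -> endv k,
  [/\ kh_morphism sc sce rho, rho HA = weightv k n,
      rho Fp = lowerv (fun=> 1) & rho Ep = vermav k n].
Proof.
apply: (kh_morphism_extension Halg Ealg (@endv_separated k) (@endv_complete k) surjFE).
move=> u v a T hu hv; have /injFE eq_uv : exists a,
    hsums sc (ser sc HA Fp Ep u) a /\ hsums sc (ser sc HA Fp Ep v) a by exists a.
apply: hsums_ext => m; rewrite /ser; congr sce.
exact: (sl2_eq_evA Ealg (sl2_rel_verma k n)) (eq_uv m).
Qed.

Section Colouring.
Variable rho : int -> A -> endv k.
Hypothesis rhoP : forall n, [/\ kh_morphism sc sce (rho n),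
  rho n HA = weightv k n, rho n Fp = lowerv (fun=> 1) & rho n Ep = vermav k n].

Definition low n i : ps k := rho n XmA (bvec k i) i.+1.
Definition rse n i : ps k := rho n XpA (bvec k i.+1) i.
Definition psi_of (kk : nat) (n : int) : ps k :=
  if kk is i.+1 then rse n i * low n i else 0.

Lemma rhoXm n : rho n XmA = lowerv (low n).
Proof.
have [rP rH _ _] := rhoP n; have [_ rm] := rho_a_rel rP Hstruct.
by rewrite rH in rm; apply: (weight_lower char0 rm).
Qed.

Lemma rhoXp n : rho n XpA = raisev (rse n).
Proof.
have [rP rH _ _] := rhoP n; have [rp _] := rho_a_rel rP Hstruct.
by rewrite rH in rp; apply: (weight_raise char0 rp).
Qed.

Lemma rho_ser n u a : hsums sc (ser sc HA Fp Ep u) a ->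
  hsums sce (ser sce (weightv k n) (lowerv (fun=> 1)) (vermav k n) u) (rho n a).
Proof. by have [rP <- <- <-] := rhoP n; apply: rho_hsums. Qed.

Lemma low_coef0 n i : low n i 0%N = 1.
Proof.
rewrite /low; have [rP _ rF _] := rhoP n.
have := in_hNA_coef (bvec k i) i.+1 (rho_in_hNA rP congF) (ltn0Sn 0).
rewrite (rhoB rP) rF => /eqP; rewrite endvEB vecEB psEB subr_eq0 => /eqP <-.
by rewrite /= bvecE eqxx mulr1.
Qed.

Lemma rse_coef0 n i : rse n i 0%N = vermac k n i.
Proof.
rewrite /rse; have [rP _ _ rE] := rhoP n.
have := in_hNA_coef (bvec k i.+1) i (rho_in_hNA rP congE) (ltn0Sn 0).
rewrite (rhoB rP) rE => /eqP; rewrite endvEB vecEB psEB subr_eq0 => /eqP <-.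
by rewrite /= bvecE eqxx mulr1.
Qed.

(** A diagonal entry of one fixed element of [A]: (C3), regularity and uniqueness are all read off
    from it. *)
Lemma psi_ofE n i : psi_of i.+1 n = rho n (XpA * XmA) (bvec k i) i.
Proof.
have [rP _ _ _] := rhoP n.
by rewrite (rhoM rP) rhoXp rhoXm /= bvecE eqxx mulr1.
Qed.

(* The shift embeds the Verma module of highest weight -n-2 in that of
   highest weight n. *)
Lemma shiftv_rho (n : nat) a :
  shiftv k n.+1 * rho (- n%:Z - 2) a = rho n%:Z a * shiftv k n.+1.
Proof.
have [u hu] := surjFE a.
exact: (intertwine_hsums Ealg (@endv_separated k) (shiftv_weightv k n)
  (shiftv_lowerv k n.+1) (shiftv_vermav k n) (rho_ser _ hu) (rho_ser _ hu)).
Qed.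

Lemma psi_of_colouring : colouring psi_of.
Proof.
split; [|split].
- case=> [//|i] n _; rewrite /= psM0E low_coef0 rse_coef0 mulr1 /vermac.
  rewrite !(rmorphM, rmorphB, rmorphD) /= -!pmulrn -!natr1; ring.
(* (C2): [b_(n+1)] is the shift of [b_0], so [X^+ b_(n+1)] is in the image of the shift and has no
   coordinate at [n]. *)
- move=> n; suff -> : psi_of n.+1 n%:Z = 0 by [].
  rewrite /= (_ : rse n%:Z n = 0) ?mul0r // /rse -[in bvec _ _](addn0 n.+1).
  by rewrite -shiftv_bvec -endvEM -shiftv_rho /= ltnSn.
(* (C3): [X^+ X^-] has the same diagonal entry at [b_(n+1+j)] in [V(n)] as at [b_j] in [V(-n-2)]. *)
- case=> [//|j] n _; suff -> : psi_of (n + j.+1).+1 n%:Z =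
    psi_of j.+1 (- n%:Z - 2) by [].
  rewrite !psi_ofE addnS -addSn -shiftv_bvec -endvEM -shiftv_rho /=.
  by rewrite ifN ?addKn //; lia.
Qed.

(** A single series for [X^+ X^-] in [g(X^-)], [g(X^+)] and [H] serves all [n]; the normal form of
    its [m]-th term yields the polynomial. *)
Lemma psi_of_regular : regular psi_of.
Proof.
move=> m; have [u hu] := surjFE (XpA * XmA).
have /choice[L LP] := @verma_evA k.
have [P PP] := verma_coef_regular (L (u m)).
exists P => -[//|i] n _; rewrite -PP psi_ofE.
apply: (ser_verma_coef (L := fun m => L (u m)) _ _ _ (rho_ser n hu)) => m' j i'.
exact: (LP (u m')).1.
Qed.

Let D n := diagv (partial_prods (low n)).

Lemma D_coef0 n i : partial_prods (low n) i 0%N = 1.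
Proof. by apply: partial_prods_coef0 => j; apply: low_coef0. Qed.

(** [D n] identifies [V_h(n, psi_of)] with the Verma module on which [rho n] acts. *)
Lemma D_rho n u a T : hsums sc (ser sc HA XmA XpA u) a ->
  hsums sce (ser sce (weightv k n) (lowerv (fun=> 1))
    (raisev (fun i => psi_of i.+1 n)) u) T ->
  D n * T = rho n a * D n.
Proof.
move=> ha hT; have [rP rH _ _] := rhoP n.
have := rho_hsums rP ha; rewrite rH rhoXm rhoXp => ha'.
exact: (intertwine_hsums Ealg (@endv_separated k) (diagv_weightv _ n)
  (diagv_lowerv _) (diagv_raisev (fun i => erefl)) hT ha').
Qed.

(** Expand both elements through [g]: the coefficients at [h^m] of the entries compare the [m]-th
    terms on all Verma modules, and these determine a class in [U(sl2)]. *)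
Lemma rho_faithful a a' :
  (forall n j, rho n a (bvec k j) = rho n a' (bvec k j)) -> a = a'.
Proof.
move=> eq_rho; have [[u hu] [u' hu']] := (surjFE a, surjFE a').
have /choice[L LP] := @verma_evA k.
have : forall m, sl2_eq (u m) (u' m).
  move=> m; apply: (verma_faithful char0) => n j i.
  rewrite !(LP _).1 /pscst /=.
  rewrite -(ser_verma_coef j i m (L := fun m => L (u m)) (rho_ser n hu)).
    rewrite -(ser_verma_coef j i m (L := fun m => L (u' m)) (rho_ser n hu')).
      by rewrite eq_rho.
    by move=> m' j' i'; apply: (LP _).1.
  by move=> m' j' i'; apply: (LP _).1.
move/injFE => [b [hb hb']].
have sep := top_free_separated Hfree.
by rewrite (hsums_inj Halg sep hu hb) (hsums_inj Halg sep hb' hu').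
Qed.

Lemma psi_of_iso : Uh_iso sc HA XmA XpA psi_of.
Proof.
split=> // u u'; split=> [[a [ha ha']] n j i M|equ].
  have [T hT] := endv_complete (fun m => evA sce (weightv k n)
    (lowerv (fun=> 1)) (raisev (fun i => psi_of i.+1 n)) (u m)).
  have [T' hT'] := endv_complete (fun m => evA sce (weightv k n)
    (lowerv (fun=> 1)) (raisev (fun i => psi_of i.+1 n)) (u' m)).
  rewrite (actUh_ser _ _ _ hT) (actUh_ser _ _ _ hT').
  suff -> : T = T' by [].
  (* Both [D n * T] and [D n * T'] equal [rho n a * D n], and the entries of [D n] have constant
     term [1]. *)
  by apply: (diagv_regl (D_coef0 n)); rewrite !(D_rho ha hT, D_rho ha' hT').
have [a ha] := top_free_complete Hfree (fun m => evA sc HA XmA XpA (u m)).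
have [a' ha'] := top_free_complete Hfree (fun m => evA sc HA XmA XpA (u' m)).
suff eaa : a = a' by exists a; split=> //; rewrite eaa.
apply: rho_faithful => n j; apply: (diagv_regr (D_coef0 n)).
have [T hT] := endv_complete (fun m => evA sce (weightv k n)
  (lowerv (fun=> 1)) (raisev (fun i => psi_of i.+1 n)) (u m)).
have [T' hT'] := endv_complete (fun m => evA sce (weightv k n)
  (lowerv (fun=> 1)) (raisev (fun i => psi_of i.+1 n)) (u' m)).
rewrite -!endvEM -(D_rho ha hT) -(D_rho ha' hT') !endvEM; congr (D n _).
apply: funext => i; apply: funext => M.
by rewrite -(actUh_ser _ _ _ hT) -(actUh_ser _ _ _ hT') equ.
Qed.

(** * Uniqueness of the colouring *)

Section Uniqueness.
Variable psi' : nat -> int -> ps k.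
Hypothesis iso' : Uh_iso sc HA XmA XpA psi'.

(** [Uh_equiv] only compares images of basis vectors; [ser_bvec_inj] upgrades this to equality of
    operators, as well-definedness requires. *)
Lemma psi_rho_exists n : exists rho' : A -> endv k,
  [/\ kh_morphism sc sce rho', rho' HA = weightv k n,
      rho' XmA = lowerv (fun=> 1) & rho' XpA = raisev (fun i => psi' i.+1 n)].
Proof.
apply: (kh_morphism_extension Halg Ealg (@endv_separated k) (@endv_complete k) surjX).
move=> u v a T hu hv hT.
have /(proj2 iso' u v) equ : exists a, hsums sc (ser sc HA XmA XpA u) a /\
  hsums sc (ser sc HA XmA XpA v) a by exists a.
have [T' hT'] := endv_complete (fun m => evA sce (weightv k n)
  (lowerv (fun=> 1)) (raisev (fun i => psi' i.+1 n)) (v m)).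
suff -> : T = T' by [].
apply: (ser_bvec_inj hT hT') => j; apply: funext => i; apply: funext => M.
by rewrite -(actUh_ser _ _ _ hT) -(actUh_ser _ _ _ hT') equ.
Qed.

Lemma psi_unique n i : psi' i.+1 n = psi_of i.+1 n.
Proof.
have [rho' [rP rH rm rp]] := psi_rho_exists n.
have := rho_sl2_rel rP Hsl2; rewrite rH => -[[relE relF] relEF].
pose f j : ps k := rho' Fp (bvec k j) j.+1.
pose e j : ps k := rho' Ep (bvec k j.+1) j.
have rF : rho' Fp = lowerv f := weight_lower char0 relF.
have rE : rho' Ep = raisev e := weight_raise char0 relE.
(* The diagonal of the relation for [g(X^+)] and [g(X^-)] is a recursion for [e j * f j], solved by
   the classical coefficients. *)
have ef j : pscst (vermac k n j) = e j * f j.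
  elim: j => [|j IH]; have := congr1 (fun T : endv k => T (bvec k _) _) relEF.
    move=> /(_ 0%N 0%N); rewrite rF rE endvEB vecEB !endvEM /= bvecE !mulr1 subr0.
    by move=> ->; rewrite muE /vermac mulr0 mul1r.
  move=> /(_ j.+1 j.+1); rewrite rF rE endvEB vecEB !endvEM /= bvecE eqxx !mulr1.
  move/eqP; rewrite subr_eq [f j * _]mulrC -IH -pscstD => /eqP ->.
  by congr pscst; rewrite muE /vermac -!natr1; ring.
have f1 j : f j 0%N = 1.
  rewrite /f; have := in_hNA_coef (bvec k j) j.+1 (rho_in_hNA rP congF) (ltn0Sn 0).
  rewrite (rhoB rP) rm => /eqP; rewrite endvEB vecEB psEB subr_eq0 => /eqP ->.
  by rewrite /= bvecE eqxx mulr1.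
have d1 := fun j => partial_prods_coef0 j f1.
have [u hu] := surjFE (XpA * XmA).
have := rho_hsums rP hu; rewrite rH rF rE => hu'.
(* Rescaling by the partial products of [f] intertwines [rho n] with [rho']; being diagonal with
   unit entries, it preserves the diagonal entry of [X^+ X^-]. *)
have := intertwine_hsums Ealg (@endv_separated k) (diagv_weightv _ n)
  (diagv_lowerv f) (diagv_raisev ef) (rho_ser n hu) hu'.
move/(congr1 (fun T : endv k => T (bvec k i) i)).
rewrite (rhoM rP) rp rm !endvEM diagv_bvec !evZ vecEZ [LHS]/= -psi_ofE => /eqP.
rewrite -subr_eq0 -mulrBr => /eqP/psmul_eq0 /eqP.
rewrite d1 oner_eq0 subr_eq0 => /(_ isT)/eqP ->.
by rewrite /= bvecE eqxx !mulr1.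
Qed.

End Uniqueness.
End Colouring.
End Main.

Theorem mainTheorem11 (k : fieldType) (char0 : [pchar k] =i pred0)
  (A : nzRingType) (sc : ps k -> A -> A) (HA XmA XpA : A)
  (Halg : kh_algebra sc) (Hstruct : a_rel HA XmA XpA)
  (Hdef : formal_deformation sc HA XmA XpA)
  (Htriv : h_trivial sc HA XmA XpA) :
  exists psi : nat -> int -> ps k,
    regular_colouring psi /\ Uh_iso sc HA XmA XpA psi /\
    (forall psi' : nat -> int -> ps k,
       regular_colouring psi' -> Uh_iso sc HA XmA XpA psi' ->
       forall (kk : nat) (n : int), (0 < kk)%N -> psi' kk n =1 psi kk n).
Proof.
have [free [approx _]] := Hdef.
have [Fp [Ep [rel [surjFE [injFE [congF [congE _]]]]]]] := Htriv.
have surjX := hsums_approx Halg approx.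
have /choice[rho rhoP] := verma_rho_exists Halg surjFE injFE.
exists (psi_of XmA XpA rho); split; [split|split].
- exact: (psi_of_colouring char0 Hstruct surjFE congF congE rhoP).
- exact: (psi_of_regular char0 Hstruct surjFE rhoP).
- exact: (psi_of_iso char0 Halg Hstruct free surjFE injFE congF surjX rhoP).
- move=> psi' _ iso' [//|i] n _ m.
  by rewrite (psi_unique char0 Halg Hstruct rel surjFE congF surjX rhoP iso').
Qed.
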